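(* Let $d\in\{2,3\}$. Express distance along an $n$-edge polygon by the fraction $\delta=k/n$, where $k$ is the number of edges skipped by a chord, and write $\mathrm{Chord}(\delta)$ for $\mathrm{Chord}(k)$. Then, with respect to the symmetric measures, $$(1-\delta)\frac{n}{n+1}<\frac{E(\mathrm{Chord}(\delta),\mathrm{Pol}_d(n))}{E(\mathrm{Chord}(\delta),\mathrm{Arm}_d(n))}<(1-\delta)\frac{n}{n-1}.$$
   Context: Polygons. For $d\in\{2,3\}$, $\mathrm{Arm}_d(n)$ is the space of lists $(e_1,\dots,e_n)$ of edge vectors in $\mathbb{R}^d$ with $\sum|e_i|=2$, and $\mathrm{Pol}_d(n)\subset\mathrm{Arm}_d(n)$ is the subspace of closed polygons, $\sum e_i=0$. For such a polygon, $\mathrm{Chord}(k)=\left|\sum_{j=1}^k e_j\right|^2$ is the squared length of the chord skipping the first $k$ edges. Hopf map. Let $\mathbb{H}$ be the quaternions with units $\mathbf i,\mathbf j,\mathbf k$. Identify $\mathbb{R}^3$ with the imaginary quaternions and $\mathbb{R}^2$ with the plane $\mathbf i\mathbb{R}\oplus\mathbf k\mathbb{R}$. Let $\mathrm{Hopf}(q)=\bar q\,\mathbf i\,q$, extended coordinatewise to $\mathbb{H}^n$, so that $q=(q_1,\dots,q_n)$ maps to the edge list $e_m=\bar q_m\mathbf i q_m$, with $|e_m|=|q_m|^2$. Identify $\mathbb{C}^n\times\mathbb{C}^n$ with $\mathbb{H}^n$ by $(a,b)\mapsto a+b\,\mathbf j$, where $\mathbb{C}=\mathbb{R}\oplus\mathbf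 i\mathbb{R}$. Symmetric measure. $\mathrm{Hopf}$ maps the following model spaces onto the polygon spaces: the sphere $S^{4n-1}\subset\mathbb{H}^n$ of radius $\sqrt2$ onto $\mathrm{Arm}_3(n)$; the disjoint union $S^{2n-1}\sqcup S^{2n-1}$ of the spheres of radius $\sqrt2$ in $(\mathbb{R}\oplus\mathbf j\mathbb{R})^n$ and $(\mathbf i\mathbb{R}\oplus\mathbf k\mathbb{R})^n$ onto $\mathrm{Arm}_2(n)$; the Stiefel manifold $V_2(\mathbb{C}^n)$ of Hermitian-orthonormal pairs $(a,b)$ in $\mathbb{C}^n$ onto $\mathrm{Pol}_3(n)$; and $V_2(\mathbb{R}^n)\sqcup\mathbf i V_2(\mathbb{R}^n)$, where $V_2(\mathbb{R}^n)$ is the set of orthonormal pairs in $\mathbb{R}^n$, onto $\mathrm{Pol}_2(n)$. The symmetric measure on each polygon space is the pushforward under $\mathrm{Hopf}$ of the Riemannian volume measure (as a submanifold of $\mathbb{H}^n$) of its model space, normalized to total mass $1$. $E(f,X)$ denotes the expectation of $f$ on $X$ with respect to the symmetric measure. *)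

(* Defs.v *)
From HB Require Import structures.
From mathcomp Require Import all_boot all_order all_algebra.
From mathcomp Require Import all_classical all_reals all_analysis.
From mathcomp Require Import complex.

Set Implicit Arguments.
Unset Strict Implicit.
Unset Printing Implicit Defensive.

Import Order.TTheory GRing.Theory Num.Theory.
Import numFieldNormedType.Exports.

Local Open Scope classical_set_scope.
Local Open Scope ring_scope.

(* Lebesgue measure on R^m, with points of R^m as m-tuples: the iterated
   product of the one-dimensional Lebesgue measure. *)
Section lebesgue_step.
Context (R : realType) (m : nat).
Variable mu : {sigma_finite_measure set (m.-tuple (measurableTypeR R)) -> \bar R}.

Definition tuple_cons (p : measurableTypeR R * m.-tuple (measurableTypeR R)) :
  m.+1.-tuple (measurableTypeR R) := [the m.+1.-tuple _ of p.1 :: p.2].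

Definition lebesgue_step : set (m.+1.-tuple (measurableTypeR R)) -> \bar R :=
  fun A => ((@lebesgue_measure R) \x mu)%E (tuple_cons @^-1` A).

Let measurable_tuple_cons : measurable_fun setT tuple_cons.
Proof. by apply: measurable_cons. Qed.

Let lebesgue_step0 : lebesgue_step set0 = 0%E.
Proof. by rewrite /lebesgue_step preimage_set0 measure0. Qed.

Let lebesgue_step_ge0 A : (0 <= lebesgue_step A)%E.
Proof. exact: measure_ge0. Qed.

Let lebesgue_step_sigma_additive : semi_sigma_additive lebesgue_step.
Proof.
have mpre A : measurable A -> measurable (tuple_cons @^-1` A).
  by move=> mA; rewrite -[X in measurable X]setTI; exact: measurable_tuple_cons.
move=> F mF tF mUF; rewrite /lebesgue_step preimage_bigcup.
apply: measure_semi_sigma_additive.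
- by move=> i; exact: mpre.
- apply/trivIsetP => i j _ _ ij; rewrite -preimage_setI.
  by move/trivIsetP : tF => ->//; rewrite preimage_set0.
- by rewrite -preimage_bigcup; exact: mpre.
Qed.

HB.instance Definition _ := isMeasure.Build _ _ _ lebesgue_step
  lebesgue_step0 lebesgue_step_ge0 lebesgue_step_sigma_additive.

Let lebesgue_step_sigma_finite : sigma_finite setT lebesgue_step.
Proof.
have /sigma_finiteP[F [TF ndF Foo]] := sigma_finiteT (@lebesgue_measure R).
have /sigma_finiteP[G [TG ndG Goo]] := sigma_finiteT mu.
pose uncons (t : m.+1.-tuple (measurableTypeR R)) :
    (measurableTypeR R * m.-tuple (measurableTypeR R))%type :=
  (thead t, [tuple of behead t]).
have muncons : measurable_fun setT uncons.
  apply: measurable_fun_pair => /=; first exact: measurable_tnth.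
  exact: measurable_behead.
have consK p : uncons (tuple_cons p) = p.
  by case: p => x t; rewrite /uncons /tuple_cons /=; congr pair; exact: val_inj.
exists (fun i => uncons @^-1` (F i `*` G i)).
  rewrite -preimage_bigcup (_ : \bigcup_i _ = setT) ?preimage_setT//.
  apply/seteqP; split => // -[x t] _.
  have [a _ Fax] : (\bigcup_k F k) x by rewrite -TF.
  have [b _ Gbt] : (\bigcup_k G k) t by rewrite -TG.
  exists (maxn a b) => //; split => /=.
  - by move: x Fax; exact/subsetPset/ndF/leq_maxl.
  - by move: t Gbt; exact/subsetPset/ndG/leq_maxr.
move=> i; have [mFi Fioo] := Foo i; have [mGi Gioo] := Goo i; split.
  rewrite -[X in measurable X]setTI; apply: muncons => //.
  exact: measurableX.
rewrite /lebesgue_step (_ : tuple_cons @^-1` _ = F i `*` G i).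
  by rewrite product_measure1E// lte_mul_pinfty// ge0_fin_numE.
by apply/funext => p; exact: (congr1 (F i `*` G i) (consK p)).
Qed.

HB.instance Definition _ := Measure_isSigmaFinite.Build _ _ _ lebesgue_step
  lebesgue_step_sigma_finite.

End lebesgue_step.

Fixpoint lebesgue_tuple (R : realType) (m : nat) :
    {sigma_finite_measure set (m.-tuple (measurableTypeR R)) -> \bar R} :=
  match m with
  | 0 => \d_([tuple] : 0.-tuple (measurableTypeR R))
  | m'.+1 => lebesgue_step (lebesgue_tuple R m')
  end.

Definition lebesgue_rV_integral (R : realType) (m : nat) (D : set 'rV[R]_m)
    (f : 'rV[R]_m -> R) : \bar R :=
  let rv (t : m.-tuple (measurableTypeR R)) : 'rV[R]_m := \row_i tnth t i in
  (\int[lebesgue_tuple R m]_(t in rv @^-1` D) (f (rv t))%:E)%E.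

(* The matrix spaces only carry a topology in the library: this is their
   Borel sigma-algebra. *)
Definition borel (T : ptopologicalType) := g_sigma_algebraType (@open T).

Definition enorm (R : realType) (n : nat) (x : 'rV[R]_n) : R :=
  Num.sqrt (\sum_(i < n) x 0 i ^+ 2).

(* phi : U -> R^N is a C^1 local parametrization of M by an open subset U of
   R^m: an immersion which is a homeomorphism onto a relatively open subset of
   M.  The i-th row of 'J phi u is the i-th partial derivative of phi at u. *)
Definition local_parametrization (R : realType) (m N : nat) (M : set 'rV[R]_N)
    (U : set 'rV[R]_m) (phi : 'rV[R]_m -> 'rV[R]_N) : Prop :=
  [/\ open U,
      forall u, U u -> differentiable phi u /\ {for u, continuous (jacobian phi)},
      forall u, U u -> row_free ('J phi u),
      {in U &, injective phi} &
      forall V : set 'rV[R]_m, open V -> V `<=` U ->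
        exists2 W : set 'rV[R]_N, open W & phi @` V = M `&` W].

Definition volume_density (R : realType) (m N : nat)
    (phi : 'rV[R]_m -> 'rV[R]_N) (u : 'rV[R]_m) : R :=
  Num.sqrt (\det ('J phi u *m ('J phi u)^T)).

(* vol is the volume measure of the m-dimensional submanifold M of R^N with the
   induced metric, seen as a measure on R^N carried by M: in every local
   parametrization it has density sqrt (det g), where g is the Gram matrix of
   the partial derivatives. *)
Definition riemannian_volume (R : realType) (m N : nat) (M : set 'rV[R]_N)
    (vol : {measure set (borel 'rV[R]_N) -> \bar R}) : Prop :=
  vol (~` M) = 0%E /\
  forall (U : set 'rV[R]_m) (phi : 'rV[R]_m -> 'rV[R]_N),
    local_parametrization M U phi ->
    forall A : set (borel 'rV[R]_N), measurable A -> A `<=` phi @` U ->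
      vol A = lebesgue_rV_integral (U `&` phi @^-1` A) (volume_density phi).

(* A quaternion x0 + x1 i + x2 j + x3 k is the row vector of its coordinates. *)
Section quaternions.
Context (R : realType).
Local Notation quat := 'rV[R]_4.

Definition mkquat (x0 x1 x2 x3 : R) : quat :=
  \row_(c < 4) [:: x0; x1; x2; x3]`_c.

Definition qc (q : quat) (c : nat) : R := q 0 (inord c).

Definition qi : quat := mkquat 0 1 0 0.
Definition qj : quat := mkquat 0 0 1 0.

Definition qmul (p q : quat) : quat := mkquat
  (qc p 0 * qc q 0 - qc p 1 * qc q 1 - qc p 2 * qc q 2 - qc p 3 * qc q 3)
  (qc p 0 * qc q 1 + qc p 1 * qc q 0 + qc p 2 * qc q 3 - qc p 3 * qc q 2)
  (qc p 0 * qc q 2 - qc p 1 * qc q 3 + qc p 2 * qc q 0 + qc p 3 * qc q 1)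
  (qc p 0 * qc q 3 + qc p 1 * qc q 2 - qc p 2 * qc q 1 + qc p 3 * qc q 0).

Definition qconj (q : quat) : quat :=
  mkquat (qc q 0) (- qc q 1) (- qc q 2) (- qc q 3).

Definition quat_of_complex (z : R[i]) : quat :=
  mkquat (complex.Re z) (complex.Im z) 0 0.

(* H^n is identified with R^(4n) through mxvec. *)
Definition qcoord (n : nat) (x : 'rV[R]_(n * 4)) (l : 'I_n) : quat :=
  row l (vec_mx x).

Definition hopf (q : quat) : quat := qmul (qmul (qconj q) qi) q.

Definition hopfn (n : nat) (x : 'rV[R]_(n * 4)) : 'M[R]_(n, 4) :=
  \matrix_(l < n) hopf (qcoord x l).

(* (a, b) |-> a + b j *)
Definition quat_of_pair (n : nat) (a b : 'cV[R[i]]_n) : 'rV[R]_(n * 4) :=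
  mxvec (\matrix_(l < n)
    (quat_of_complex (a l 0) + qmul (quat_of_complex (b l 0)) qj)).

End quaternions.

Section polygons.
Context (R : realType).

(* Lists of n edges in R^d, the rows of the matrix. *)
Definition Arm (d n : nat) : set 'M[R]_(n, d) :=
  [set e | \sum_(l < n) enorm (row l e) = 2].

Definition Pol (d n : nat) : set 'M[R]_(n, d) :=
  [set e | Arm e /\ \sum_(l < n) row l e = 0].

Definition Chord (d n k : nat) (e : 'M[R]_(n, d)) : R :=
  enorm (\sum_(l < n | (l < k)%N) row l e) ^+ 2.

(* R^3 is the space of imaginary quaternions and R^2 is the plane iR + kR
   (only meant for d = 2 and d = 3). *)
Definition quat_slot (d i : nat) : nat :=
  nth 0%N (if d == 2 then [:: 1%N; 3%N] else [:: 1%N; 2%N; 3%N]) i.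

Definition quat_of_edges (d n : nat) (e : 'M[R]_(n, d)) : 'M[R]_(n, 4) :=
  \matrix_(l < n, c < 4) \sum_(i < d | quat_slot d i == c) e l i.

Definition arm_model3 (n : nat) : set 'rV[R]_(n * 4) :=
  [set x | enorm x = Num.sqrt 2].

Definition arm_model2 (n : nat) : set 'rV[R]_(n * 4) :=
  [set x | enorm x = Num.sqrt 2 /\
           forall l, qc (qcoord x l) 1 = 0 /\ qc (qcoord x l) 3 = 0] `|`
  [set x | enorm x = Num.sqrt 2 /\
           forall l, qc (qcoord x l) 0 = 0 /\ qc (qcoord x l) 2 = 0].

Definition stiefelC (n : nat) : set ('cV[R[i]]_n * 'cV[R[i]]_n)%type :=
  [set p : 'cV[R[i]]_n * 'cV[R[i]]_n |
          [/\ \sum_l p.1 l 0 * conjc (p.1 l 0) = 1,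
               \sum_l p.2 l 0 * conjc (p.2 l 0) = 1 &
               \sum_l p.1 l 0 * conjc (p.2 l 0) = 0]].

Definition stiefelR (n : nat) : set ('cV[R]_n * 'cV[R]_n)%type :=
  [set p : 'cV[R]_n * 'cV[R]_n |
          [/\ \sum_l p.1 l 0 * p.1 l 0 = 1,
               \sum_l p.2 l 0 * p.2 l 0 = 1 &
               \sum_l p.1 l 0 * p.2 l 0 = 0]].

Definition pol_model3 (n : nat) : set 'rV[R]_(n * 4) :=
  [set quat_of_pair p.1 p.2 | p in stiefelC (n := n)].

Definition pol_model2 (n : nat) : set 'rV[R]_(n * 4) :=
  let C (a : 'cV[R]_n) : 'cV[R[i]]_n := map_mx (real_complex R) a in
  [set quat_of_pair (C p.1) (C p.2) | p in stiefelR (n := n)] `|`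
  [set quat_of_pair ('i%C *: C p.1) ('i%C *: C p.2) | p in stiefelR (n := n)].

(* sigma is the normalized pushforward under the Hopf map of the volume of the
   m-dimensional model space M.  Since sigma is a probability, the last
   equation forces 0 < vol M < +oo. *)
Definition symmetric_measure (d n m : nat) (M : set 'rV[R]_(n * 4))
    (sigma : probability (borel 'M[R]_(n, d)) R) : Prop :=
  exists vol : {measure set (borel 'rV[R]_(n * 4)) -> \bar R},
    riemannian_volume m M vol /\
    forall A : set (borel 'M[R]_(n, d)), measurable A ->
      sigma A =
      ((fine (vol M))^-1%:E *
       vol (M `&` @hopfn R n @^-1` (@quat_of_edges d n @` A)))%E.

Definition arm_symmetric_measure (d n : nat) :=
  if d == 2 then @symmetric_measure d n (2 * n - 1) (@arm_model2 n)
  else @symmetric_measure d n (4 * n - 1) (@arm_model3 n).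

(* dim V_2(R^n) = 2n - 3 and dim V_2(C^n) = 4n - 4. *)
Definition pol_symmetric_measure (d n : nat) :=
  if d == 2 then @symmetric_measure d n (2 * n - 3) (@pol_model2 n)
  else @symmetric_measure d n (4 * n - 4) (@pol_model3 n).

Definition expect (d n : nat) (sigma : probability (borel 'M[R]_(n, d)) R)
    (f : 'M[R]_(n, d) -> R) (X : set 'M[R]_(n, d)) : R :=
  Rintegral sigma X f.

End polygons.

(* Main.v *)
From HB Require Import structures.
Require Import Defs.
From mathcomp Require Import all_boot all_order all_algebra.
From mathcomp Require Import all_classical all_reals all_analysis.
From mathcomp Require Import measurable_realfun complex ring lra zify.

Set Implicit Arguments.
Unset Strict Implicit.
Unset Printing Implicit Defensive.

Import Order.TTheory GRing.Theory Num.Theory.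
Import numFieldNormedType.Exports.

Local Open Scope classical_set_scope.
Local Open Scope ring_scope.

(* The model spaces are quadratic, so every linear isometry of R^(4n) that
   preserves a model space preserves its Riemannian volume: it permutes the
   local parametrizations and leaves their densities unchanged, and the volume
   is determined by its values on a finite cover by charts.  Charts come from
   gnomonic projection for the spheres, and from Gram-Schmidt
   orthonormalization of an affine slice for the Stiefel manifolds.

   Invariance under permutations (up to sign) of the edges, under the rotations
   by pi/4 mixing two coordinates q_l and q_m, and under left multiplication of
   one q_l by i or j (when the model space allows it) yields linear relations
   between the moments E|q_l|^4, E|q_l|^2|q_m|^2 and E(Re q_l conj(q_m))^2.
   With sum |q_l|^2 = 2 and, for closed polygons, the idempotency of the
   projection a a^* + b b^*, they determine E|e_l|^2 = E|q_l|^4.  The scalar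
   products <e_l, e_m>, l <> m, have mean 0 on Arm, and the same mean for all
   pairs on Pol, where they sum up with |e_l|^2 to zero.  Hence
     E(Chord(k), Arm) = k A,   E(Chord(k), Pol) = k (n - k) / (n - 1) B,
   where A and B are the values of E|e_l|^2 on Arm and Pol, and
   B / A = (n + 1) / (n + 2) for d = 2 and (2n + 1) / (2n + 2) for d = 3. *)

(** The assumption on the volume is local: it fixes [vol] only on images of local parametrizations
    and says nothing until charts are exhibited around every point. Each chart is therefore a map on
    all of R^m that comes with an explicit differentiable left inverse; the chain rule then gives
    immersion, and continuity gives openness, without an inverse function theorem. No density is
    ever integrated, so each model must supply enough symmetries, and these differ. Left
    multiplication of one q_l by i moves along the Hopf fibre: it fixes all edges but changes q_l
    conj(q_m). Left multiplication by j sends e_l to -e_l, so it kills the mean of <e_l, e_m> on Arm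
    but cannot preserve closedness; on Pol the idempotency of the projection replaces it. The
    rotation by pi/4 is what links E|q_l|^4 to mixed moments, which permutations alone cannot do. *)

Section topology.
Context (R : realType).

Lemma cvg_mx (T : Type) (F : set_system T) (FF : Filter F) m n
    (f : T -> 'M[R]_(m, n)) (l : 'M[R]_(m, n)) :
  (forall i j, (fun t => f t i j) @ F --> l i j) -> f @ F --> l.
Proof.
move=> fl A [P nP PA].
have : \forall t \near F, forall i j, P i j (f t i j).
  by apply: filter_forall => i; apply: filter_forall => j; exact: fl.
by rewrite nbhs_simpl; apply: filterS => t Pt; exact: PA.
Qed.

Lemma continuous_at_mx (T : topologicalType) m n (f : T -> 'M[R]_(m, n)) t :
  (forall i j, {for t, continuous (fun s => f s i j)}) ->
  {for t, continuous f}.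
Proof. by move=> cf; apply: cvg_mx => i j; exact: cf. Qed.

Lemma continuous_mx (T : topologicalType) m n (f : T -> 'M[R]_(m, n)) :
  (forall i j, continuous (fun t => f t i j)) -> continuous f.
Proof. by move=> cf t; apply: continuous_at_mx => i j; exact: cf. Qed.

Lemma continuous_sumr (T : topologicalType) (I : Type) (s : seq I) (P : pred I)
    (f : I -> T -> R) :
  (forall i, P i -> continuous (f i)) ->
  continuous (fun t => \sum_(i <- s | P i) f i t).
Proof.
move=> cf; elim: s => [|i s IH].
  rewrite (_ : (fun t => _) = cst 0); first exact: cst_continuous.
  by apply/funext => t; rewrite big_nil.
have [Pi|nPi] := boolP (P i); last first.
  rewrite (_ : (fun t => _) = fun t => \sum_(j <- s | P j) f j t)//.
  by apply/funext => t; rewrite big_cons (negbTE nPi).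
rewrite (_ : (fun t => _) = fun t => f i t + \sum_(j <- s | P j) f j t).
  by move=> t; apply: cvgD; [exact: cf|exact: IH].
by apply/funext => t; rewrite big_cons Pi.
Qed.

Lemma continuousM_fun (T : topologicalType) (f g : T -> R) :
  continuous f -> continuous g -> continuous (fun t => f t * g t).
Proof. by move=> cf cg t; apply: cvgM; [exact: cf|exact: cg]. Qed.

Lemma continuousD_fun (T : topologicalType) (f g : T -> R) :
  continuous f -> continuous g -> continuous (fun t => f t + g t).
Proof. by move=> cf cg t; apply: cvgD; [exact: cf|exact: cg]. Qed.

Lemma continuousN_fun (T : topologicalType) (f : T -> R) :
  continuous f -> continuous (fun t => - f t).
Proof. by move=> cf t; apply: cvgN; exact: cf. Qed.

Lemma continuousX_fun (T : topologicalType) (f : T -> R) (n : nat) :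
  continuous f -> continuous (fun t => f t ^+ n).
Proof.
move=> cf; elim: n => [|n IH]; first exact: cst_continuous.
rewrite (_ : (fun t => _) = fun t => f t * f t ^+ n).
  exact: continuousM_fun.
by apply/funext => t; rewrite exprS.
Qed.

Lemma continuousV_fun (T : topologicalType) (f : T -> R) :
  (forall t, f t != 0) -> continuous f -> continuous (fun t => (f t)^-1).
Proof. by move=> f0 cf t; apply: cvgV; [exact: f0|exact: cf]. Qed.

Lemma mulmxr_continuous m n p (B : 'M[R]_(n, p)) :
  continuous (fun A : 'M[R]_(m, n) => A *m B).
Proof.
apply: continuous_mx => i j.
rewrite (_ : (fun A => _) = fun A : 'M[R]_(m, n) => \sum_(k < n) A i k * B k j); last first.
  by apply/funext => A; rewrite mxE.
apply: continuous_sumr => k _; apply: continuousM_fun.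
  exact: coord_continuous.
exact: cst_continuous.
Qed.

End topology.

(** * Invariance of the Riemannian volume under linear isometries *)

Section orthogonal_invariance.
Context (R : realType).

Lemma row_jacobian m N (f : 'rV[R]_m -> 'rV[R]_N) u i :
  row i ('J f u) = 'd f u (delta_mx 0 i).
Proof. by rewrite rowE mul_rV_lin1. Qed.

Lemma differentiable_mulmxr m N p (phi : 'rV[R]_m -> 'rV[R]_N) (T : 'M[R]_(N, p))
    u :
  differentiable phi u -> differentiable (fun v => phi v *m T) u.
Proof.
move=> dphi; apply: (@differentiable_comp _ _ _ _ phi (mulmxr T)) => //.
by apply: linear_differentiable; exact: mulmxr_continuous.
Qed.

Section moved_parametrization.
Context (m N : nat) (M : set 'rV[R]_N) (T : 'M[R]_N).
Hypothesis TT : T *m T^T = 1%:M.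
Hypothesis MT : forall x, M (x *m T) <-> M x.
Context (U : set 'rV[R]_m) (phi : 'rV[R]_m -> 'rV[R]_N).

Lemma jacobian_mulmxr u : differentiable phi u ->
  'J (fun v => phi v *m T) u = 'J phi u *m T.
Proof.
move=> dphi.
have cT : continuous (mulmxr T : 'rV[R]_N -> 'rV[R]_N).
  exact: mulmxr_continuous.
have dT : 'd (fun v => phi v *m T) u = 'd (mulmxr T) (phi u) \o 'd phi u
    :> (_ -> _).
  apply: (@diff_comp _ _ _ _ phi (mulmxr T)) => //.
  exact: linear_differentiable.
apply/row_matrixP => i.
by rewrite row_jacobian dT /= diff_lin// [RHS]row_mul row_jacobian.
Qed.

Lemma volume_density_mulmxr u : differentiable phi u ->
  volume_density (fun v => phi v *m T) u = volume_density phi u.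
Proof.
move=> dphi; rewrite /volume_density (jacobian_mulmxr dphi) trmx_mul mulmxA.
by rewrite -(mulmxA _ T) TT mulmx1.
Qed.

Lemma local_parametrization_mulmxr :
  local_parametrization M U phi ->
  local_parametrization M U (fun v => phi v *m T).
Proof.
case=> oU dU rU iU hU.
have TK : T^T *m T = 1%:M by exact: mulmx1C.
split; first exact: oU.
- move=> u Uu; have [dphi cphi] := dU u Uu.
  split; first exact: differentiable_mulmxr.
  rewrite /prop_for /continuous_at (jacobian_mulmxr dphi).
  have : {for u, continuous (fun v => 'J phi v *m T)}.
    have cT : {for 'J phi u, continuous (fun A : 'M[R]_(m, N) => A *m T)}.
      exact: mulmxr_continuous.
    exact: continuous_comp cphi cT.
  (* The product formula for the Jacobian is available only at points of [U], so continuity at [u]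
     is transferred through an equality valid near [u]. *)
  apply: cvg_trans; apply: (@near_eq_cvg _ _ (nbhs u)).
  have : nbhs u U by exact: open_nbhs_nbhs.
  apply: filterS => v Uv /=.
  by have [dv _] := dU v Uv; rewrite (jacobian_mulmxr dv).
- move=> u Uu; have [dphi _] := dU u Uu.
  rewrite (jacobian_mulmxr dphi).
  rewrite /row_free mxrankMfree; first exact: rU.
  by rewrite row_free_unit; have [] := mulmx1_unit TT.
- move=> u v Uu Uv /(congr1 (mulmx^~ T^T)); rewrite -!mulmxA TT !mulmx1.
  exact: iU.
- move=> V oV VU; have [W oW VW] := hU V oV VU.
  exists ((fun y => y *m T^T) @^-1` W).
    by apply: open_comp => // y _; exact: mulmxr_continuous.
  apply/seteqP; split => [_ [v Vv <-]|y [My Wy]] /=.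
    have [Mv Wv] : (M `&` W) (phi v) by rewrite -VW; exists v.
    by split; [exact/MT|rewrite /= -mulmxA TT mulmx1].
  have : (M `&` W) (y *m T^T) by split => //; apply/MT; rewrite -mulmxA TK mulmx1.
  by rewrite -VW => -[v Vv yE]; exists v => //; rewrite yE -mulmxA TK mulmx1.
Qed.

End moved_parametrization.

(** Complements [riemannian_volume], which constrains [vol] only inside chart images: a chart at
    each point is what determines the volume on all of [M]. *)
Definition has_charts m N (M : set 'rV[R]_N) :=
  forall x, M x -> exists (U : set 'rV[R]_m) (phi : 'rV[R]_m -> 'rV[R]_N),
    local_parametrization M U phi /\ (phi @` U) x.

Lemma open_borel (T : ptopologicalType) (A : set T) :
  open A -> measurable (A : set (borel T)).
Proof. exact: sub_sigma_algebra. Qed.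

Lemma closed_borel (T : ptopologicalType) (A : set T) :
  closed A -> measurable (A : set (borel T)).
Proof.
move=> cA; rewrite -[A]setCK; apply: measurableC.
by apply: open_borel; rewrite openC.
Qed.

Lemma continuous_borel (T T' : ptopologicalType) (f : T -> T') :
  continuous f -> measurable_fun setT (f : borel T -> borel T').
Proof.
move=> cf; apply: (@measurability _ _ (borel T) (borel T') setT f (@open T')) => //.
move=> _ [B oB <-]; rewrite setTI; apply: open_borel.
by apply: open_comp => // x _; exact: cf.
Qed.

(** If [A] lies in the image of a chart [phi], its preimage lies in the image of the chart
    [phi *m T^T], and both volumes are integrals of the same density over the same domain. A general
    [A] is cut into finitely many such pieces by compactness of [M]. *)
Lemma riemannian_volume_mulmxr m N (M : set 'rV[R]_N) (T : 'M[R]_N)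
    (vol : {measure set (borel 'rV[R]_N) -> \bar R}) :
  compact M -> has_charts m M -> riemannian_volume m M vol ->
  T *m T^T = 1%:M -> (forall x, M (x *m T) <-> M x) ->
  forall A : set (borel 'rV[R]_N), measurable A ->
    vol ((fun x => x *m T) @^-1` A) = vol A.
Proof.
move=> cM chM [vM0 vM] TT MT.
have TK : T^T *m T = 1%:M by exact: mulmx1C.
have mT : measurable_fun setT
    ((fun x => x *m T) : borel 'rV[R]_N -> borel 'rV[R]_N).
  by apply: continuous_borel; exact: mulmxr_continuous.
have mTI (A : set (borel 'rV[R]_N)) : measurable A ->
    measurable ((fun x => x *m T) @^-1` A : set (borel 'rV[R]_N)).
  by move=> mA; rewrite -[X in measurable X]setTI; exact: mT.
have mM : measurable (M : set (borel 'rV[R]_N)).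
  by apply: closed_borel; apply: compact_closed => //; exact: norm_hausdorff.
have chart (U : set 'rV[R]_m) phi : local_parametrization M U phi ->
    forall A : set (borel 'rV[R]_N), measurable A -> A `<=` phi @` U ->
    vol ((fun x => x *m T) @^-1` A) = vol A.
  move=> lp A mA AU.
  have TTT : T^T *m T^T^T = 1%:M by rewrite trmxK.
  have MTT x : M (x *m T^T) <-> M x.
    by rewrite -[X in _ <-> M X]mulmx1 -TK mulmxA; split => /MT.
  rewrite (vM _ _ lp A mA AU).
  rewrite (vM _ _ (local_parametrization_mulmxr TTT MTT lp)); last 2 first.
    exact: (mTI A mA).
    by move=> x /= /AU[u Uu ux]; exists u => //; rewrite ux -mulmxA TT mulmx1.
  have -> : U `&` (fun v => phi v *m T^T) @^-1` ((fun x => x *m T) @^-1` A) =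
            U `&` phi @^-1` A.
    by apply/seteqP; split => u [Uu] /=; rewrite -mulmxA TK mulmx1.
  rewrite /lebesgue_rV_integral; apply: eq_integral => t /set_mem[/= Ut _].
  case: lp => _ dU _ _ _; have [dphi _] := dU _ Ut.
  by rewrite (volume_density_mulmxr TTT dphi).
(* Invariance is recorded on ambient open sets [W x], the form that the covering property of compact
   sets expects; outside [M] the value [setT] is a placeholder. *)
have [W WP] : {W : 'rV[R]_N -> set 'rV[R]_N & forall x, M x ->
    [/\ open (W x), W x x & forall A : set (borel 'rV[R]_N), measurable A ->
       A `<=` M `&` W x -> vol ((fun x => x *m T) @^-1` A) = vol A]}.
  apply: (@choice _ _ (fun x W => M x -> [/\ open W, W x & forall A : set (borel 'rV[R]_N),
     measurable A -> A `<=` M `&` W -> vol ((fun x => x *m T) @^-1` A) = vol A])).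
  move=> x; have [Mx|nMx] := pselect (M x); last by exists setT.
  have [U [phi [lp Ux]]] := chM x Mx.
  have [_ _ _ _ hU] := lp.
  have [|W oW UW] := hU U _ (@subset_refl _ U); first by case: lp.
  exists W => _; split => //; first by move: Ux; rewrite UW => -[].
  by move=> A mA; rewrite -UW; exact: chart lp A mA.
move: (cM); rewrite compact_cover => /(_ _ M W).
case=> [x /WP[]//|x Mx|D DM MD].
  by exists x => //; have [] := WP x Mx.
(* Induction on the finite cover: the part of [A] in [W y] lies in one chart, and the rest is
   covered by the remaining sets. *)
have piece (s : seq 'rV[R]_N) : {subset s <= M} ->
    forall A : set (borel 'rV[R]_N), measurable A -> A `<=` M ->
    A `<=` [set x | exists2 y, y \in s & W y x] ->
    vol ((fun x => x *m T) @^-1` A) = vol A.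
  elim: s => [|y s IH] sM A mA AM As.
    have -> : A = set0 by apply/seteqP; split => // x /As[].
    by rewrite preimage_set0.
  have My : M y by apply/set_mem/sM; rewrite mem_head.
  have [oW _ WA] := WP y My.
  have mW : measurable (W y : set (borel 'rV[R]_N)) by exact: open_borel.
  rewrite (measureDI vol (mTI _ mA) (mTI _ mW)) (measureDI vol mA mW) addeC.
  rewrite [RHS]addeC.
  congr (_ + _)%E; first apply: WA => [|x []].
  - exact: measurableI.
  - by split => //; exact: AM.
  apply: IH => [x xs||x []|x [Ax nWx]].
  - by apply: sM; rewrite inE xs orbT.
  - exact: measurableD.
  - by move=> /AM.
  - by have [z] := As x Ax; rewrite inE => /predU1P[->//|zs Wzx]; exists z.
move=> A mA.
have split_vol (B : set (borel 'rV[R]_N)) : measurable B -> vol B = vol (B `&` M).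
  move=> mB; rewrite (measureDI vol mB mM) addeC.
  rewrite -[RHS]adde0; congr (_ + _)%E; apply/eqP.
  rewrite eq_le measure_ge0 andbT -vM0 le_measure ?inE//.
  - exact: measurableD mB mM.
  - exact: measurableC.
rewrite split_vol; last exact: mTI.
rewrite (split_vol A)//.
rewrite -(piece (finmap.enum_fset D) _ (A `&` M)); first last.
- by move=> x [_ /MD[y yD Wyx]]; exists y.
- by [].
- exact: measurableI.
- by move=> x /DM.
congr (vol _); apply/seteqP; split => x [Ax Mx]; split => //; exact/MT.
Qed.

End orthogonal_invariance.

(** * Calculus of C^1 functions on R^m *)

Section continuously_differentiable.
Context (R : realType) (m : nat).
Implicit Types f g : 'rV[R]_m -> R.

(** Continuity is asked of each directional derivative separately, which in finite dimension amounts
    to continuity of the Jacobian. The class is global because every chart built below has domain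
    [setT]. *)
Record C1 f : Prop := {
  C1_differentiable : forall u, differentiable f u ;
  C1_diff : forall v, continuous (fun u => 'd f u v) }.

Lemma C1_diffE f (df : 'rV[R]_m -> 'rV[R]_m -> R) :
  (forall u, differentiable f u) -> (forall u v, 'd f u v = df u v) ->
  (forall v, continuous (df^~ v)) -> C1 f.
Proof.
move=> Df dfE cdf; split; first exact: Df.
move=> v; rewrite (_ : (fun w => _) = df^~ v); first exact: cdf.
by apply/funext => w; rewrite dfE.
Qed.

Lemma C1_continuous f : C1 f -> continuous f.
Proof. by move=> Cf u; exact: differentiable_continuous (C1_differentiable Cf u). Qed.

Lemma C1_cst (c : R) : C1 (fun=> c).
Proof.
apply: (@C1_diffE _ (fun _ _ => 0)) => [u|u v|v].
- exact: differentiable_cst.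
- by rewrite diff_cst.
- exact: cst_continuous.
Qed.

Lemma C1D f g : C1 f -> C1 g -> C1 (fun u => f u + g u).
Proof.
move=> Cf Cg.
have Df u := C1_differentiable Cf u; have Dg u := C1_differentiable Cg u.
apply: (@C1_diffE _ (fun u v => 'd f u v + 'd g u v)) => [u|u v|v].
- exact: (differentiableD (Df u) (Dg u)).
- exact: (congr1 (@^~ v) (diffD (Df u) (Dg u))).
- by apply: continuousD_fun; exact: C1_diff.
Qed.

Lemma C1M f g : C1 f -> C1 g -> C1 (fun u => f u * g u).
Proof.
move=> Cf Cg.
have Df u := C1_differentiable Cf u; have Dg u := C1_differentiable Cg u.
apply: (@C1_diffE _ (fun u v => f u * 'd g u v + g u * 'd f u v)) => [u|u v|v].
- exact: (differentiableM (Df u) (Dg u)).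
- exact: (congr1 (@^~ v) (diffM (Df u) (Dg u))).
- by apply: continuousD_fun; apply: continuousM_fun;
    [exact: C1_continuous|exact: C1_diff|exact: C1_continuous|exact: C1_diff].
Qed.

Lemma C1N f : C1 f -> C1 (fun u => - f u).
Proof.
move=> Cf; rewrite (_ : (fun u => _) = fun u => (-1) * f u).
  by apply: C1M => //; exact: C1_cst.
by apply/funext => u; rewrite mulN1r.
Qed.

Lemma C1B f g : C1 f -> C1 g -> C1 (fun u => f u - g u).
Proof. by move=> Cf Cg; apply: C1D => //; exact: C1N. Qed.

Lemma C1_sum (I : Type) (s : seq I) (f : I -> 'rV[R]_m -> R) :
  (forall i, C1 (f i)) -> C1 (fun u => \sum_(i <- s) f i u).
Proof.
move=> Cf; elim: s => [|i s IH].
  rewrite (_ : (fun u => _) = fun=> 0); first exact: C1_cst.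
  by apply/funext => u; rewrite big_nil.
rewrite (_ : (fun u => _) = fun u => f i u + \sum_(j <- s) f j u).
  exact: C1D.
by apply/funext => u; rewrite big_cons.
Qed.

Lemma diff_coord N (phi : 'rV[R]_m -> 'rV[R]_N) u v j :
  differentiable phi u -> 'd (fun w => phi w 0 j) u v = 'd phi u v 0 j.
Proof.
move=> Dphi; pose f : 'rV[R]_N -> R := fun w => w 0 j.
have fL : linear f by move=> k w z; rewrite /f !mxE.
pose fM := GRing.isLinear.Build _ _ _ _ f fL.
pose F : {linear 'rV[R]_N -> R} := HB.pack f fM.
have cF : continuous F by exact: coord_continuous.
have DF w : differentiable F w by exact: differentiable_coord.
have -> : 'd (fun w => phi w 0 j) u = 'd F (phi u) \o 'd phi u :> (_ -> _).
  exact: (diff_comp Dphi (DF (phi u))).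
by rewrite /= (diff_lin (phi u) cF).
Qed.

Lemma C1_coord i : C1 (fun u => u 0 i).
Proof.
apply: (@C1_diffE _ (fun u v => v 0 i)) => [u|u v|v].
- exact: differentiable_coord.
- by rewrite (diff_coord (phi := id)) ?diff_val.
- exact: cst_continuous.
Qed.

Lemma C1V f : (forall u, f u != 0) -> C1 f -> C1 (fun u => (f u)^-1).
Proof.
move=> f0 Cf; have Df u := C1_differentiable Cf u.
apply: (@C1_diffE _ (fun u v => - (f u) ^- 2 * 'd f u v)) => [u|u v|v].
- exact: differentiableV.
- exact: (congr1 (@^~ v) (diffV (Df u) (f0 u))).
- apply: continuousM_fun; last exact: C1_diff.
  apply: continuousN_fun; apply: continuousV_fun => [u|].
    exact: expf_neq0 (f0 u).
  exact: continuousX_fun (C1_continuous Cf).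
Qed.

Lemma C1_sqrt f : (forall u, 0 < f u) -> C1 f -> C1 (fun u => Num.sqrt (f u)).
Proof.
move=> f0 Cf; have Df u := C1_differentiable Cf u.
have csf : continuous (fun u => Num.sqrt (f u)).
  move=> u; apply: continuous_comp; first exact: C1_continuous.
  exact: sqrt_continuous.
have Ds (x : R) : 0 < x -> differentiable (@Num.sqrt R) x.
  by move=> x0; apply/derivable1_diffP; have [] := is_derive1_sqrt x0.
apply: (@C1_diffE _ (fun u v => 'd f u v * (2 * Num.sqrt (f u))^-1)) => [u|u v|v].
- exact: differentiable_comp (Df u) (Ds _ (f0 u)).
- have -> : 'd (fun w => Num.sqrt (f w)) u v =
      'd (@Num.sqrt R) (f u) ('d f u v).
    exact: (congr1 (@^~ v) (diff_comp (Df u) (Ds _ (f0 u)))).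
  rewrite diff1E; last exact: Ds.
  by rewrite derive1E (derive_sqrt (f0 u)).
- apply: continuousM_fun; first exact: C1_diff.
  apply: continuousV_fun => [u|].
    by rewrite mulf_neq0 ?pnatr_eq0// sqrtr_eq0 -ltNge.
  have c2 : continuous (fun _ : 'rV[R]_m => 2 : R) by exact: cst_continuous.
  exact: continuousM_fun c2 csf.
Qed.

Lemma differentiable_rV N (phi : 'rV[R]_m -> 'rV[R]_N) u :
  (forall j, differentiable (fun w => phi w 0 j) u) -> differentiable phi u.
Proof.
move=> Dphi.
rewrite (_ : phi = \sum_(j < N) fun w => phi w 0 j *: delta_mx 0 j); last first.
  by apply/funext => w; rewrite fct_sumE [LHS]row_sum_delta.
by apply: differentiable_sum => j; apply: differentiableZl; exact: Dphi.
Qed.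

Lemma C1_jacobian N (phi : 'rV[R]_m -> 'rV[R]_N) :
  (forall j, C1 (fun w => phi w 0 j)) ->
  forall u, differentiable phi u /\ {for u, continuous (jacobian phi)}.
Proof.
move=> Cphi.
have Dphi u : differentiable phi u.
  by apply: differentiable_rV => j; exact: C1_differentiable.
move=> u; split; first exact: Dphi.
apply: continuous_at_mx => i j.
have JE w : 'J phi w i j = 'd (fun z => phi z 0 j) w (delta_mx 0 i).
  by rewrite (diff_coord _ _ (Dphi w)) -row_jacobian [RHS]mxE.
rewrite (_ : (fun w => _) = fun w => 'd (fun z => phi z 0 j) w (delta_mx 0 i)).
  exact: (C1_diff (Cphi j)).
by apply/funext => w; exact: JE.
Qed.

End continuously_differentiable.

(** * Charts parametrized by an affine slice, and charts of disjoint unions *)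

Section charts.
Context (R : realType).

(** The left inverse [L] forces [A] to have rank [c], so its left kernel has dimension [m]; the rows
    of [K] are a basis of it, and [K'] reads off coordinates. *)
Lemma row_basis_kernel (m c N : nat) (A : 'M[R]_(N, c)) (L : 'M[R]_(c, N)) :
  L *m A = 1%:M -> (m + c = N)%N ->
  exists (K : 'M[R]_(m, N)) (K' : 'M[R]_(N, m)), K *m K' = 1%:M /\
    forall y : 'rV[R]_N, y *m A = 0 <-> exists u, y = u *m K.
Proof.
move=> LA mcN.
have rA : \rank A = c.
  apply/eqP; rewrite eqn_leq rank_leq_col /=.
  by rewrite -{1}(mxrank1 R c) -LA mxrankM_maxr.
have rK : \rank (kermx A) = m by rewrite mxrank_ker rA -mcN addnK.
pose K : 'M[R]_(m, N) := castmx (rK, erefl N) (row_base (kermx A)).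
have KE : (K :=: kermx A)%MS.
  by apply: eqmx_trans (eq_row_base _); exact: eqmx_cast.
have /row_freeP[K' KK'] : row_free K by rewrite /row_free KE rK.
exists K, K'; split => // y; split.
  by move/sub_kermxP; rewrite -KE => /submxP.
by move=> yK; apply/sub_kermxP; rewrite -KE; apply/submxP.
Qed.

(** [G] carries the slice onto the part of [M] in [W], and [h] carries it back. The left inverse
    [psi] of [phi] is differentiable, so differentiating [psi \o phi = id] gives the immersion
    property, and continuity of [psi] gives relative openness of the images. *)
Lemma local_parametrization_section (m N : nat) (M W : set 'rV[R]_N)
    (x0 : 'rV[R]_N) (K : 'M[R]_(m, N)) (K' : 'M[R]_(N, m))
    (G h : 'rV[R]_N -> 'rV[R]_N) :
  K *m K' = 1%:M ->
  open W ->
  (forall j, C1 (fun u : 'rV[R]_m => G (x0 + u *m K) 0 j)) ->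
  (forall x, W x -> differentiable h x) ->
  (forall u, [/\ M (G (x0 + u *m K)), W (G (x0 + u *m K)) &
                 h (G (x0 + u *m K)) = x0 + u *m K]) ->
  (forall x, M x -> W x -> exists2 u, h x = x0 + u *m K & G (h x) = x) ->
  exists2 phi : 'rV[R]_m -> 'rV[R]_N, local_parametrization M setT phi &
    M `&` W `<=` phi @` setT.
Proof.
move=> KK' oW C1G dh Gu hx; pose phi u := G (x0 + u *m K).
pose psi x := (h x - x0) *m K'.
have phiK u : psi (phi u) = u.
  by rewrite /psi; have [_ _ ->] := Gu u; rewrite [x0 + _]addrC addrK -mulmxA KK' mulmx1.
have psiK x : M x -> W x -> phi (psi x) = x.
  move=> Mx Wx; have [u hE GE] := hx x Mx Wx.
  have -> : psi x = u by rewrite /psi hE [x0 + _]addrC addrK -mulmxA KK' mulmx1.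
  by rewrite /phi -hE.
have [dphi cJ] : (forall u, differentiable phi u) /\ continuous (jacobian phi).
  by split => u; have [] := C1_jacobian C1G u.
have dpsi x : W x -> differentiable psi x.
  move=> Wx; apply: (differentiable_mulmxr (phi := fun x => h x - x0)).
  by apply: differentiableB; [exact: dh|exact: differentiable_cst].
exists phi; last by move=> x [Mx Wx]; exists (psi x) => //; exact: psiK.
split.
- exact: openT.
- by move=> u _; split; [exact: dphi|exact: cJ].
- move=> u _; apply/row_freeP; exists ('J psi (phi u)).
  have [_ Wu _] := Gu u.
  have dK : 'd psi (phi u) \o 'd phi u = id :> (_ -> _).
    rewrite -(diff_comp (dphi u) (dpsi _ Wu)).
    rewrite (_ : psi \o phi = id) ?diff_val//.
    by apply/funext => v; exact: phiK.
  apply/row_matrixP => i; rewrite [LHS]row_mul row_jacobian.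
  rewrite /jacobian mul_rV_lin1 [LHS](congr1 (@^~ _) dK).
  by rewrite row1.
- by move=> u v _ _ uv; rewrite -(phiK u) uv phiK.
(* [psi] is controlled only on [W], hence the intersection, whose openness is checked point by
   point. *)
- move=> V oV _; exists (W `&` psi @^-1` V).
    rewrite openE => x [Wx Vx]; apply: filterI.
      exact: open_nbhs_nbhs.
    have : nbhs (psi x) V by exact: open_nbhs_nbhs.
    exact: (differentiable_continuous (dpsi x Wx)).
  apply/seteqP; split => [_ [v Vv <-]|x [Mx [Wx Vx]]].
    by have [Mv Wv _] := Gu v; split => //; split => //=; rewrite phiK.
  by exists (psi x) => //; exact: psiK.
Qed.

Lemma local_parametrization_openI (m N : nat) (M M' W : set 'rV[R]_N) :
  open W -> M `<=` W -> (forall x, W x -> M x <-> M' x) ->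
  forall (U : set 'rV[R]_m) phi, local_parametrization M U phi ->
  local_parametrization M' U phi.
Proof.
move=> oW MW MM' U phi [oU dU rU iU hU]; split.
- exact: oU.
- exact: dU.
- exact: rU.
- exact: iU.
- move=> V oV VU; have [W' oW' VW'] := hU V oV VU; exists (W' `&` W).
    exact: openI.
  rewrite VW'; apply/seteqP; split => x.
    by move=> [Mx W'x]; have Wx := MW x Mx; split; [exact/MM'|].
  by move=> [M'x [W'x Wx]]; split => //; exact/MM'.
Qed.

(** Each piece is relatively open in the union, the other one being closed and disjoint from it, so
    its charts are charts of the union. *)
Lemma has_chartsU (m N : nat) (M1 M2 : set 'rV[R]_N) :
  closed M1 -> closed M2 -> M1 `&` M2 = set0 ->
  has_charts m M1 -> has_charts m M2 -> has_charts m (M1 `|` M2).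
Proof.
move=> c1 c2 M12 ch1 ch2 x [M1x|M2x].
  have [U [phi [lp Ux]]] := ch1 x M1x; exists U, phi; split => //.
  apply: (@local_parametrization_openI _ _ M1 _ (~` M2)) lp => [||y M2y].
  - by rewrite openC.
  - by move=> y M1y M2y; have : (M1 `&` M2) y by []; rewrite M12.
  - by split=> [|[]//]; left.
have [U [phi [lp Ux]]] := ch2 x M2x; exists U, phi; split => //.
apply: (@local_parametrization_openI _ _ M2 _ (~` M1)) lp => [||y M1y].
- by rewrite openC.
- by move=> y M2y M1y; have : (M1 `&` M2) y by []; rewrite M12.
- by split=> [|[]//]; right.
Qed.

End charts.

(** * Hermitian products in real coordinates, Gram-Schmidt and its inverse *)

Section coordinates.
Context (R : realType) (n : nat).
Implicit Types x y : 'rV[R]_(n * 4).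

Lemma qc_mkquat (a b c d : R) (i : nat) : (i < 4)%N ->
  qc (mkquat a b c d) i = [:: a; b; c; d]`_i.
Proof. by move=> i4; rewrite /qc mxE inordK. Qed.

Definition co x (c : nat) (l : 'I_n) : R := qc (qcoord x l) c.

Lemma coE x c l : co x c l = x 0 (mxvec_index l (inord c)).
Proof. by rewrite /co /qc /qcoord !mxE. Qed.

Lemma co_inj x y : (forall c l, (c < 4)%N -> co x c l = co y c l) -> x = y.
Proof.
move=> xy; apply/rowP => j; case/mxvec_indexP: j => l c.
by have := xy c l (ltn_ord c); rewrite !coE inord_val.
Qed.

Lemma co_mxvec (q : 'I_n -> 'rV[R]_4) c l :
  co (mxvec (\matrix_(l < n) q l)) c l = qc (q l) c.
Proof. by rewrite /co /qcoord mxvecK rowK. Qed.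

Lemma coD x y c l : co (x + y) c l = co x c l + co y c l.
Proof. by rewrite !coE mxE. Qed.

Lemma coZ a x c l : co (a *: x) c l = a * co x c l.
Proof. by rewrite !coE mxE. Qed.

(** Euclidean product of two of the four coordinate vectors in R^n. All model spaces are described
    by the numbers [csum i j x x], which orthogonal mixing of the edges leaves unchanged. *)
Definition csum (i j : nat) x y : R := \sum_(l < n) co x i l * co y j l.

Lemma csum_sym i j x y : csum i j x y = csum j i y x.
Proof. by apply: eq_bigr => l _; rewrite mulrC. Qed.

Lemma csum_ge0 i x : 0 <= csum i i x x.
Proof. by apply: sumr_ge0 => l _; rewrite -expr2 sqr_ge0. Qed.

Lemma csum_eq0 i x : csum i i x x = 0 -> forall l, co x i l = 0.
Proof.
move/eqP; rewrite psumr_eq0 => [/allP h l|l _]; last by rewrite -expr2 sqr_ge0.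
by have /implyP/(_ isT) := h l (mem_index_enum l); rewrite -expr2 sqrf_eq0 => /eqP.
Qed.

Lemma csum_zerol i j x y : (forall l, co x i l = 0) -> csum i j x y = 0.
Proof. by move=> x0; apply: big1 => l _; rewrite x0 mul0r. Qed.

Lemma csum_zeror i j x y : (forall l, co y j l = 0) -> csum i j x y = 0.
Proof. by move=> x0; apply: big1 => l _; rewrite x0 mulr0. Qed.

Lemma csumDl i j x y z : csum i j (x + y) z = csum i j x z + csum i j y z.
Proof. by rewrite -big_split /=; apply: eq_bigr => l _; rewrite coD mulrDl. Qed.

Lemma csumZl i j a x z : csum i j (a *: x) z = a * csum i j x z.
Proof. by rewrite mulr_sumr; apply: eq_bigr => l _; rewrite coZ mulrA. Qed.

Lemma csumZr i j a x z : csum i j x (a *: z) = a * csum i j x z.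
Proof. by rewrite csum_sym csumZl csum_sym. Qed.

Lemma dotE x y : (x *m y^T) 0 0 = csum 0 0 x y + csum 1 1 x y + csum 2 2 x y + csum 3 3 x y.
Proof.
rewrite mxE; under eq_bigr do rewrite mxE.
rewrite (reindex _ (curry_mxvec_bij _ _)) /=.
transitivity (\sum_(l < n) \sum_(c < 4)
    x 0 (mxvec_index l c) * y 0 (mxvec_index l c)).
  by rewrite pair_bigA; apply: eq_bigr => -[l c].
rewrite -!big_split /=; apply: eq_bigr => l _.
rewrite !big_ord_recl big_ord0 !coE addr0 !addrA.
by congr (_ * _ + _ * _ + _ * _ + _ * _); congr (_ 0 (mxvec_index _ _));
  apply/val_inj; rewrite /= ?inordK.
Qed.

Lemma enorm_sqr x : enorm x ^+ 2 = csum 0 0 x x + csum 1 1 x x + csum 2 2 x x + csum 3 3 x x.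
Proof.
rewrite -dotE /enorm sqr_sqrtr; last by apply: sumr_ge0 => i _; rewrite sqr_ge0.
by rewrite mxE; apply: eq_bigr => i _; rewrite mxE expr2.
Qed.

(* With x = (a, b) in C^n x C^n, this is (s a, t b + (c1 + i c2) a). *)
Definition act (s t c1 c2 : R) x : 'rV[R]_(n * 4) :=
  mxvec (\matrix_(l < n) mkquat (s * co x 0 l) (s * co x 1 l)
    (t * co x 2 l + c1 * co x 0 l - c2 * co x 1 l)
    (t * co x 3 l + c1 * co x 1 l + c2 * co x 0 l)).

Lemma co_act s t c1 c2 x c l : (c < 4)%N -> co (act s t c1 c2 x) c l =
  [:: s * co x 0 l; s * co x 1 l; t * co x 2 l + c1 * co x 0 l - c2 * co x 1 l;
      t * co x 3 l + c1 * co x 1 l + c2 * co x 0 l]`_c.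
Proof. by move=> c4; rewrite co_mxvec qc_mkquat. Qed.

Lemma act_act s t c1 c2 s' t' c1' c2' x :
  act s' t' c1' c2' (act s t c1 c2 x) =
  act (s' * s) (t' * t) (t' * c1 + c1' * s) (t' * c2 + c2' * s) x.
Proof.
apply: co_inj => c l c4; rewrite !co_act//.
by case: c c4 => [|[|[|[|]]]] //= _; ring.
Qed.

Lemma act1 x : act 1 1 0 0 x = x.
Proof.
apply: co_inj => c l c4; rewrite !co_act//.
by case: c c4 => [|[|[|[|]]]] //= _; ring.
Qed.

Section act_left.
Context (s t c1 c2 : R) (x y : 'rV[R]_(n * 4)) (j : nat).
Lemma csum0_act : csum 0 j (act s t c1 c2 x) y = s * csum 0 j x y.
Proof. by rewrite mulr_sumr; apply: eq_bigr => l _; rewrite co_act//= mulrA. Qed.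

Lemma csum1_act : csum 1 j (act s t c1 c2 x) y = s * csum 1 j x y.
Proof. by rewrite mulr_sumr; apply: eq_bigr => l _; rewrite co_act//= mulrA. Qed.

Lemma csum2_act : csum 2 j (act s t c1 c2 x) y =
  t * csum 2 j x y + c1 * csum 0 j x y - c2 * csum 1 j x y.
Proof.
rewrite !mulr_sumr -sumrN -!big_split; apply: eq_bigr => l _ /=.
by rewrite co_act//=; ring.
Qed.

Lemma csum3_act : csum 3 j (act s t c1 c2 x) y =
  t * csum 3 j x y + c1 * csum 1 j x y + c2 * csum 0 j x y.
Proof.
rewrite !mulr_sumr -!big_split; apply: eq_bigr => l _ /=.
by rewrite co_act//=; ring.
Qed.
End act_left.

Lemma act_r s t c1 c2 x y i :
  (csum i 0 y (act s t c1 c2 x) = s * csum i 0 y x) *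
  (csum i 1 y (act s t c1 c2 x) = s * csum i 1 y x) *
  (csum i 2 y (act s t c1 c2 x) = t * csum i 2 y x + c1 * csum i 0 y x - c2 * csum i 1 y x) *
  (csum i 3 y (act s t c1 c2 x) = t * csum i 3 y x + c1 * csum i 1 y x + c2 * csum i 0 y x).
Proof.
by rewrite !(csum_sym i) csum0_act csum1_act csum2_act csum3_act !(csum_sym _ i).
Qed.

Definition csum_act := (csum0_act, csum1_act, csum2_act, csum3_act, act_r).

(* For x = (a, b) and y = (a', b') these are the real and imaginary parts of
   the Hermitian products <a, a'>, <b, a'>, <b, b'> and <a, b'> (up to the sign
   of the imaginary part for the last one). *)
Definition aaRe x y := csum 0 0 x y + csum 1 1 x y.
Definition aaIm x y := csum 1 0 x y - csum 0 1 x y.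
Definition baRe x y := csum 2 0 x y + csum 3 1 x y.
Definition baIm x y := csum 3 0 x y - csum 2 1 x y.
Definition bbRe x y := csum 2 2 x y + csum 3 3 x y.
Definition abRe x y := csum 0 2 x y + csum 1 3 x y.
Definition abIm x y := csum 0 3 x y - csum 1 2 x y.

Section hermitian_act.
Context (s t c1 c2 : R) (x y : 'rV[R]_(n * 4)).
Let z := act s t c1 c2 x.

Lemma aaRe_act : aaRe z y = s * aaRe x y.
Proof. by rewrite /aaRe /z !csum_act; ring. Qed.
Lemma aaIm_act : aaIm z y = s * aaIm x y.
Proof. by rewrite /aaIm /z !csum_act; ring. Qed.
Lemma baRe_act : baRe z y = t * baRe x y + c1 * aaRe x y - c2 * aaIm x y.
Proof. by rewrite /baRe /aaRe /aaIm /z !csum_act; ring. Qed.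
Lemma baIm_act : baIm z y = t * baIm x y + c1 * aaIm x y + c2 * aaRe x y.
Proof. by rewrite /baIm /aaRe /aaIm /z !csum_act; ring. Qed.
Lemma bbRe_act : bbRe z y = t * bbRe x y + c1 * abRe x y + c2 * abIm x y.
Proof. by rewrite /bbRe /abRe /abIm /z !csum_act; ring. Qed.
Lemma abRe_act : abRe z y = s * abRe x y.
Proof. by rewrite /abRe /z !csum_act; ring. Qed.
Lemma abIm_act : abIm z y = s * abIm x y.
Proof. by rewrite /abIm /z !csum_act; ring. Qed.

Lemma aaRe_act2 : aaRe z z = s ^+ 2 * aaRe x x.
Proof. by rewrite /aaRe /z !csum_act; ring. Qed.
Lemma baRe_act2 : baRe z z = s * (t * baRe x x + c1 * aaRe x x).
Proof. by rewrite /baRe /aaRe /z !csum_act (csum_sym 1 0); ring. Qed.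
Lemma baIm_act2 : baIm z z = s * (t * baIm x x + c2 * aaRe x x).
Proof. by rewrite /baIm /aaRe /z !csum_act (csum_sym 1 0); ring. Qed.
Lemma bbRe_act2 : bbRe z z = t ^+ 2 * bbRe x x + (c1 ^+ 2 + c2 ^+ 2) * aaRe x x
  + 2 * t * (c1 * baRe x x + c2 * baIm x x).
Proof.
rewrite /bbRe /baRe /baIm /aaRe /z !csum_act.
by rewrite (csum_sym 1 0) (csum_sym 0 2) (csum_sym 1 2) (csum_sym 0 3) (csum_sym 1 3); ring.
Qed.

End hermitian_act.

Lemma aaRe_eq0 x y : aaRe x x = 0 -> aaRe x y = 0.
Proof.
move/eqP; rewrite paddr_eq0 ?csum_ge0// => /andP[/eqP/csum_eq0 h0 /eqP/csum_eq0 h1].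
by rewrite /aaRe !csum_zerol ?addr0.
Qed.

Lemma bbRe_eq0 x y : bbRe x x = 0 ->
  [/\ bbRe x y = 0, baRe x y = 0 & baIm x y = 0].
Proof.
move/eqP; rewrite paddr_eq0 ?csum_ge0// => /andP[/eqP/csum_eq0 h0 /eqP/csum_eq0 h1].
by rewrite /bbRe /baRe /baIm !csum_zerol ?addr0 ?subr0.
Qed.

(** Four real equations, the vanishing of <b, a> counting twice: hence codimension 4. *)
Definition stiefel_set : set 'rV[R]_(n * 4) :=
  [set x | [/\ aaRe x x = 1, bbRe x x = 1, baRe x x = 0 & baIm x x = 0]].

(** Squared norm of the component of b orthogonal to a. *)
Definition gram x := bbRe x x - (baRe x x ^+ 2 + baIm x x ^+ 2) / aaRe x x.

(** Written as an [act] with coefficients depending on [x]: such maps are triangular changes of the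
    pair (a, b), so inverting them reduces to [act_act]. *)
Definition gram_schmidt x :=
  act (Num.sqrt (aaRe x x))^-1 (Num.sqrt (gram x))^-1
    (- (baRe x x / aaRe x x) / Num.sqrt (gram x))
    (- (baIm x x / aaRe x x) / Num.sqrt (gram x)) x.

(** Uniqueness of the triangular factor: since [s] and [t] are positive, the square roots return
    them without a sign. *)
Lemma gram_schmidtK s t c1 c2 x : 0 < s -> 0 < t -> stiefel_set x ->
  gram_schmidt (act s t c1 c2 x) = x.
Proof.
move=> s0 t0 [a1 b1 r0 i0].
have s1 : s != 0 by rewrite gt_eqF. have t1 : t != 0 by rewrite gt_eqF.
have gE : gram (act s t c1 c2 x) = t ^+ 2.
  rewrite /gram aaRe_act2 bbRe_act2 baRe_act2 baIm_act2 a1 b1 r0 i0.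
  by field.
rewrite /gram_schmidt gE aaRe_act2 baRe_act2 baIm_act2 a1 r0 i0 mulr1.
rewrite !sqrtr_sqr !gtr0_norm// act_act -[RHS]act1.
by congr act; field; rewrite ?s1 ?t1.
Qed.

Lemma gram_schmidt_stiefel x : 0 < aaRe x x -> 0 < gram x ->
  stiefel_set (gram_schmidt x).
Proof.
move=> a0 g0; have : Num.sqrt (aaRe x x) != 0 by rewrite sqrtr_eq0 -ltNge.
have : Num.sqrt (gram x) != 0 by rewrite sqrtr_eq0 -ltNge.
move: (sqr_sqrtr (ltW a0)) (sqr_sqrtr (ltW g0)); rewrite /gram_schmidt.
move: (Num.sqrt (gram x)) (Num.sqrt (aaRe x x)) => g a a2 g2 gN0 aN0.
have a1 : aaRe x x != 0 by rewrite gt_eqF.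
split.
- by rewrite aaRe_act2 -a2; field.
- rewrite bbRe_act2; transitivity (g ^- 2 * gram x).
    by rewrite /gram; field; rewrite a1 gN0.
  by rewrite -g2 mulVf ?expf_neq0.
- by rewrite baRe_act2; field; rewrite a1 aN0 gN0.
- by rewrite baIm_act2; field; rewrite a1 aN0 gN0.
Qed.

Section normalization.
Variable x0 : 'rV[R]_(n * 4).

(** The Stiefel equations with one argument frozen at [x0]: they become affine in [y] and define the
    slice. The imaginary parts of <a, a0> and <b, b0> stay free. *)
Definition normalized y :=
  [/\ aaRe y x0 = 1, bbRe y x0 = 1, baRe y x0 = 0 & baIm y x0 = 0].

(** With x0 = (a0, b0), [proj_re] and [proj_im] are the real and imaginary parts of <b, a0> / <a,
    a0>, the multiple of a to subtract from b to make it orthogonal to a0; [bbRest] is the real part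
    of the product of that difference with b0. *)
Definition aaSq x := aaRe x x0 ^+ 2 + aaIm x x0 ^+ 2.
Definition proj_re x := (baRe x x0 * aaRe x x0 + baIm x x0 * aaIm x x0) / aaSq x.
Definition proj_im x := (baIm x x0 * aaRe x x0 - baRe x x0 * aaIm x x0) / aaSq x.
Definition bbRest x := bbRe x x0 - proj_re x * abRe x x0 - proj_im x * abIm x x0.

Definition normalize x :=
  act (aaRe x x0)^-1 (bbRest x)^-1
    (- proj_re x / bbRest x) (- proj_im x / bbRest x) x.

Lemma normalizedP x : aaRe x x0 != 0 -> bbRest x != 0 -> normalized (normalize x).
Proof.
move=> a0 b0.
have d0 : aaSq x != 0.
  by rewrite /aaSq gt_eqF// ltr_pwDl ?sqr_ge0// exprn_even_gt0.
have [k1E k2E] : baRe x x0 = proj_re x * aaRe x x0 - proj_im x * aaIm x x0 /\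
    baIm x x0 = proj_re x * aaIm x x0 + proj_im x * aaRe x x0.
  by split; rewrite /proj_re /proj_im /aaSq; field.
have bE : bbRe x x0 =
    bbRest x + proj_re x * abRe x x0 + proj_im x * abIm x x0.
  by rewrite /bbRest; ring.
rewrite /normalize; split.
- by rewrite aaRe_act mulVf.
- by rewrite bbRe_act bE; field.
- by rewrite baRe_act k1E; field.
- by rewrite baIm_act k2E; field.
Qed.

Lemma normalize_act s t c1 c2 y : s != 0 -> normalized y ->
  [/\ proj_re (act s t c1 c2 y) = c1 / s, proj_im (act s t c1 c2 y) = c2 / s &
      bbRest (act s t c1 c2 y) = t].
Proof.
move=> s0 [a1 b1 r0 i0].
have d0 : s ^+ 2 + (s * aaIm y x0) ^+ 2 != 0.
  by rewrite gt_eqF// ltr_pwDl ?sqr_ge0// exprn_even_gt0.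
have k1E : proj_re (act s t c1 c2 y) = c1 / s.
  rewrite /proj_re /aaSq !(aaRe_act, aaIm_act, baRe_act, baIm_act) a1 r0 i0.
  by field; rewrite s0 d0.
have k2E : proj_im (act s t c1 c2 y) = c2 / s.
  rewrite /proj_im /aaSq !(aaRe_act, aaIm_act, baRe_act, baIm_act) a1 r0 i0.
  by field; rewrite s0 d0.
split=> //; rewrite /bbRest k1E k2E bbRe_act abRe_act abIm_act b1.
by field.
Qed.

Lemma normalizeK s t c1 c2 y : s != 0 -> t != 0 -> normalized y ->
  normalize (act s t c1 c2 y) = y.
Proof.
move=> s0 t0 ny; have [kr ki rr] := normalize_act t c1 c2 s0 ny.
case: ny => a1 b1 r0 i0.
rewrite /normalize kr ki rr aaRe_act a1 act_act -[RHS]act1.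
by congr act; field; rewrite ?s0 ?t0.
Qed.

Lemma normalized_aa_gt0 y : normalized y -> 0 < aaRe y y.
Proof.
move=> [a1 _ _ _]; rewrite lt_neqAle addr_ge0 ?csum_ge0// andbT eq_sym.
apply/eqP => /(@aaRe_eq0 _ x0); rewrite a1 => /eqP; exact/negP/oner_neq0.
Qed.

(** If [gram y] vanished, b would be a complex multiple of a. As <b, a0> = 0 while <a, a0> has real
    part 1, the multiple would be zero, so b = 0, against Re <b, b0> = 1. *)
Lemma normalized_gram_gt0 y : normalized y -> 0 < gram y.
Proof.
move=> ny; have a0 := normalized_aa_gt0 ny.
have a1 : aaRe y y != 0 by rewrite gt_eqF.
pose c1 := - (baRe y y / aaRe y y); pose c2 := - (baIm y y / aaRe y y).
pose z := act 1 1 c1 c2 y.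
have -> : gram y = bbRe z z.
  by rewrite /z bbRe_act2 /gram /c1 /c2; field.
rewrite lt_neqAle addr_ge0 ?csum_ge0// andbT eq_sym.
apply/eqP => /(@bbRe_eq0 _ x0)[]; rewrite /z bbRe_act baRe_act baIm_act.
case: ny => -> -> -> ->; rewrite !mulr1 !mulr0 !add0r => bz rz iz.
have d0 : 1 + aaIm y x0 ^+ 2 != 0 by rewrite gt_eqF// ltr_pwDl ?sqr_ge0.
(* [rz] and [iz] form a real 2 by 2 linear system in [c1], [c2] with determinant
   [1 + aaIm y x0 ^+ 2]. *)
have c10 : c1 = 0.
  apply: (mulfI d0); rewrite mulr0.
  transitivity ((c1 - c2 * aaIm y x0) + (c1 * aaIm y x0 + c2) * aaIm y x0); first ring.
  by rewrite rz iz mul0r addr0.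
have c20 : c2 = 0 by move: iz; rewrite c10 mul0r add0r.
by move: bz; rewrite c10 c20 !mul0r !addr0 => /eqP; rewrite oner_eq0.
Qed.

End normalization.

End coordinates.

(** * Regularity of polynomial expressions in the coordinates *)

Section function_classes.
Context (R : realType).

(* Continuity, differentiability at a point and being C^1 all pass to
   polynomial expressions: this is stated once for the three classes. *)
Record ring_class (T : Type) (P : (T -> R) -> Prop) : Prop := {
  class_cst : forall c, P (fun=> c) ;
  class_add : forall f g, P f -> P g -> P (fun t => f t + g t) ;
  class_mul : forall f g, P f -> P g -> P (fun t => f t * g t) }.

Lemma ring_class_C1 m : ring_class (@C1 R m).
Proof. by split; [exact: C1_cst|exact: C1D|exact: C1M]. Qed.

Lemma ring_class_continuous (T : topologicalType) :
  ring_class (fun f : T -> R => continuous f).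
Proof.
by split; [move=> c; exact: cst_continuous|exact: continuousD_fun|
  exact: continuousM_fun].
Qed.

Lemma ring_class_differentiable m (x : 'rV[R]_m) :
  ring_class (fun f : 'rV[R]_m -> R => differentiable f x).
Proof.
split=> [c|f g df dg|f g df dg].
- exact: differentiable_cst.
- exact: (differentiableD df dg).
- exact: (differentiableM df dg).
Qed.

Section closure.
Context (T : Type) (P : (T -> R) -> Prop) (PC : ring_class P).

Lemma class_opp f : P f -> P (fun t => - f t).
Proof.
move=> Pf; rewrite (_ : (fun t => _) = fun t => (-1) * f t).
  exact: (class_mul PC (class_cst PC (-1)) Pf).
by apply/funext => t; rewrite mulN1r.
Qed.

Lemma class_sub f g : P f -> P g -> P (fun t => f t - g t).
Proof. by move=> Pf Pg; apply: class_add => //; exact: class_opp. Qed.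

Lemma class_sqr f : P f -> P (fun t => f t ^+ 2).
Proof.
move=> Pf; rewrite (_ : (fun t => _) = fun t => f t * f t).
  exact: (class_mul PC Pf Pf).
by apply/funext => t; rewrite expr2.
Qed.

Lemma class_sum (I : Type) (s : seq I) (Q : pred I) (f : I -> T -> R) :
  (forall i, P (f i)) -> P (fun t => \sum_(i <- s | Q i) f i t).
Proof.
move=> Pf; elim: s => [|i s IH].
  rewrite (_ : (fun t => _) = fun=> 0); first exact: class_cst.
  by apply/funext => t; rewrite big_nil.
case Qi : (Q i); last first.
  rewrite (_ : (fun t => _) = fun t => \sum_(j <- s | Q j) f j t)//.
  by apply/funext => t; rewrite big_cons Qi.
rewrite (_ : (fun t => _) = fun t => f i t + \sum_(j <- s | Q j) f j t).
  exact: class_add.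
by apply/funext => t; rewrite big_cons Qi.
Qed.

Context (n : nat).
Definition class_coords (y : T -> 'rV[R]_(n * 4)) := forall j, P (fun t => y t 0 j).

Lemma class_coords_cst y : class_coords (fun=> y).
Proof. by move=> j; exact: class_cst. Qed.

Section forms.
Context (y z : T -> 'rV[R]_(n * 4)).
Hypotheses (Py : class_coords y) (Pz : class_coords z).

Lemma class_co c l : P (fun t => co (y t) c l).
Proof.
rewrite (_ : (fun t => _) = fun t => y t 0 (mxvec_index l (inord c))).
  exact: Py.
by apply/funext => t; rewrite coE.
Qed.

Lemma class_S i j : P (fun t => csum i j (y t) (z t)).
Proof.
apply: class_sum => l; apply: class_mul => //; first exact: class_co.
rewrite (_ : (fun t => _) = fun t => z t 0 (mxvec_index l (inord j))).
  exact: Pz.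
by apply/funext => t; rewrite coE.
Qed.

Lemma class_aaRe : P (fun t => aaRe (y t) (z t)).
Proof. by apply: class_add => //; exact: class_S. Qed.
Lemma class_aaIm : P (fun t => aaIm (y t) (z t)).
Proof. by apply: class_sub => //; exact: class_S. Qed.
Lemma class_baRe : P (fun t => baRe (y t) (z t)).
Proof. by apply: class_add => //; exact: class_S. Qed.
Lemma class_baIm : P (fun t => baIm (y t) (z t)).
Proof. by apply: class_sub => //; exact: class_S. Qed.
Lemma class_bbRe : P (fun t => bbRe (y t) (z t)).
Proof. by apply: class_add => //; exact: class_S. Qed.
Lemma class_abRe : P (fun t => abRe (y t) (z t)).
Proof. by apply: class_add => //; exact: class_S. Qed.
Lemma class_abIm : P (fun t => abIm (y t) (z t)).
Proof. by apply: class_sub => //; exact: class_S. Qed.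

Lemma class_act s t c1 c2 : P s -> P t -> P c1 -> P c2 ->
  class_coords (fun u => act (s u) (t u) (c1 u) (c2 u) (y u)).
Proof.
move=> Ps Pt Pc1 Pc2 j; case/mxvec_indexP: j => l c.
rewrite (_ : (fun t => _) = fun u => co (act (s u) (t u) (c1 u) (c2 u) (y u)) c l); last first.
  by apply/funext => u; rewrite coE inord_val.
have -> : (fun u => co (act (s u) (t u) (c1 u) (c2 u) (y u)) c l) =
  (fun u => [:: s u * co (y u) 0 l; s u * co (y u) 1 l;
      t u * co (y u) 2 l + c1 u * co (y u) 0 l - c2 u * co (y u) 1 l;
      t u * co (y u) 3 l + c1 u * co (y u) 1 l + c2 u * co (y u) 0 l]`_c).
  by apply/funext => u; rewrite co_act.
by case: c => -[|[|[|[|]]]] //= _;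
  repeat first [apply: (class_sub) | apply: (class_add PC) | apply: (class_mul PC)];
  solve [exact: class_co | assumption].
Qed.

End forms.
End closure.
End function_classes.

(** * Charts of the Stiefel manifolds *)

Section model_charts.
Context (R : realType) (n : nat).
Notation N := (n * 4)%N.
Implicit Types x y : 'rV[R]_N.

Definition sphere_set : set 'rV[R]_N :=
  [set x | csum 0 0 x x + csum 1 1 x x + csum 2 2 x x + csum 3 3 x x = 2].

Definition has_basis m (E : set 'rV[R]_N) := exists (K : 'M[R]_(m, N)) (K' : 'M[R]_(N, m)),
  K *m K' = 1%:M /\ forall y, E y <-> exists u, y = u *m K.

Lemma class_affine m (K : 'M[R]_(m, N)) x0 :
  class_coords (@C1 R m) (fun u => x0 + u *m K).
Proof.
move=> j; rewrite (_ : (fun u => _) = fun u : 'rV[R]_m => x0 0 j + \sum_k u 0 k * K k j).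
  apply: C1D; first exact: C1_cst.
  by apply: C1_sum => k; apply: C1M; [exact: C1_coord|exact: C1_cst].
by apply/funext => u; rewrite mxE; congr (_ + _); rewrite mxE.
Qed.

Lemma class_id (x : 'rV[R]_N) :
  class_coords (fun f : 'rV[R]_N -> R => differentiable f x) id.
Proof. by move=> j; exact: differentiable_coord. Qed.

Lemma class_id_continuous :
  class_coords (fun f : 'rV[R]_N -> R => continuous f) id.
Proof. by move=> j; exact: coord_continuous. Qed.

Lemma open_positive (T : topologicalType) (f : T -> R) :
  continuous f -> open [set t | 0 < f t].
Proof.
move=> cf; apply: (@open_comp _ _ f [set y | 0 < y]); last exact: open_gt.
by move=> t _; exact: cf.
Qed.

Section stiefel_charts.
Context (m : nat) (V : set 'rV[R]_N).
Hypothesis VD : forall x y, V x -> V y -> V (x + y).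
Hypothesis VB : forall x y, V x -> V y -> V (x - y).
Hypothesis VG : forall x, V x -> V (gram_schmidt x).
Hypothesis VN : forall x0 x, V x0 -> V x -> V (normalize x0 x).
Hypothesis basis : forall x0, stiefel_set x0 -> V x0 -> has_basis m
  [set y | V y /\ [/\ aaRe y x0 = 0, bbRe y x0 = 0, baRe y x0 = 0 & baIm y x0 = 0]].

Lemma normalizedD x0 y e : normalized x0 y ->
  [/\ aaRe e x0 = 0, bbRe e x0 = 0, baRe e x0 = 0 & baIm e x0 = 0] ->
  normalized x0 (y + e).
Proof.
move=> [a b c d] [a' b' c' d']; split.
- by rewrite -a -[RHS]addr0 -a' /aaRe !csumDl; ring.
- by rewrite -b -[RHS]addr0 -b' /bbRe !csumDl; ring.
- by rewrite -c -[RHS]addr0 -c' /baRe !csumDl; ring.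
- by rewrite -d -[RHS]addr0 -d' /baIm !csumDl; ring.
Qed.

Lemma normalizedB x0 y y' : normalized x0 y -> normalized x0 y' ->
  [/\ aaRe (y - y') x0 = 0, bbRe (y - y') x0 = 0, baRe (y - y') x0 = 0 &
      baIm (y - y') x0 = 0].
Proof.
rewrite -scaleN1r; move=> [a b c d] [a' b' c' d']; split.
- transitivity (aaRe y x0 - aaRe y' x0); last by rewrite a a' subrr.
  by rewrite /aaRe !csumDl !csumZl; ring.
- transitivity (bbRe y x0 - bbRe y' x0); last by rewrite b b' subrr.
  by rewrite /bbRe !csumDl !csumZl; ring.
- transitivity (baRe y x0 - baRe y' x0); last by rewrite c c' subrr.
  by rewrite /baRe !csumDl !csumZl; ring.
- transitivity (baIm y x0 - baIm y' x0); last by rewrite d d' subrr.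
  by rewrite /baIm !csumDl !csumZl; ring.
Qed.

(** [bbRest] cleared of its denominator [aaSq]: a polynomial, continuous everywhere, so that the
    chart domain is visibly open. *)
Definition bbPoly x0 x := bbRe x x0 * aaSq x0 x
  - (baRe x x0 * aaRe x x0 + baIm x x0 * aaIm x x0) * abRe x x0
  - (baIm x x0 * aaRe x x0 - baRe x x0 * aaIm x x0) * abIm x x0.

Lemma bbPolyE x0 x : 0 < aaRe x x0 -> bbPoly x0 x = bbRest x0 x * aaSq x0 x.
Proof.
move=> a0; have d0 : aaSq x0 x != 0.
  by rewrite /aaSq gt_eqF// ltr_pwDl ?sqr_ge0// exprn_gt0.
by rewrite /bbRest /proj_re /proj_im /bbPoly; field.
Qed.

Definition chart_domain x0 : set 'rV[R]_N :=
  [set x | 0 < aaRe x x0] `&` [set x | 0 < bbPoly x0 x].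

Lemma chart_domainP x0 x : chart_domain x0 x <-> 0 < aaRe x x0 /\ 0 < bbRest x0 x.
Proof.
split=> -[a0 b0]; split => //; have d0 : 0 < aaSq x0 x
    by rewrite /aaSq ltr_pwDl ?sqr_ge0// exprn_gt0.
- by move: b0; rewrite /= bbPolyE// pmulr_lgt0.
- by rewrite /= bbPolyE// pmulr_lgt0.
Qed.

Lemma open_chart_domain x0 : open (chart_domain x0).
Proof.
have RC := ring_class_continuous R 'rV[R]_N.
have id_c := class_id_continuous; have cst_c := class_coords_cst RC x0.
have aR := class_aaRe RC id_c cst_c; have aI := class_aaIm RC id_c cst_c.
have bR := class_baRe RC id_c cst_c; have bI := class_baIm RC id_c cst_c.
have bb := class_bbRe RC id_c cst_c.
have cR := class_abRe RC id_c cst_c; have cI := class_abIm RC id_c cst_c.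
apply: openI; apply: open_positive; first exact: aR.
apply: (class_sub RC); [apply: (class_sub RC)|]; apply: (class_mul RC).
- exact: bb.
- by apply: (class_add RC); apply: (class_sqr RC).
- by apply: (class_add RC); apply: (class_mul RC).
- exact: cR.
- by apply: (class_sub RC); apply: (class_mul RC).
- exact: cI.
Qed.

Lemma C1_gram_schmidt (K : 'M[R]_(m, N)) x0 :
  (forall u, 0 < aaRe (x0 + u *m K) (x0 + u *m K)) ->
  (forall u, 0 < gram (x0 + u *m K)) ->
  class_coords (@C1 R m) (fun u => gram_schmidt (x0 + u *m K)).
Proof.
have RC := ring_class_C1 R m; have aff := class_affine K x0.
have aR := class_aaRe RC aff aff; have bR := class_baRe RC aff aff.
have bI := class_baIm RC aff aff; have bb := class_bbRe RC aff aff.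
move=> a0 g0.
have aV := C1V (fun u => lt0r_neq0 (a0 u)) aR.
have C1g : C1 (fun u => gram (x0 + u *m K)).
  apply: C1B => //; apply: C1M => //.
  by apply: C1D; apply: (class_sqr RC).
have sV (f : 'rV[R]_m -> R) : (forall u, 0 < f u) -> C1 f ->
    C1 (fun u => (Num.sqrt (f u))^-1).
  move=> f0 Cf; apply: C1V; last exact: C1_sqrt.
  by move=> u; rewrite sqrtr_eq0 -ltNge.
have C1gs := sV _ g0 C1g.
apply: class_act => //; first exact: sV.
- by apply: C1M => //; apply: C1N; apply: C1M.
- by apply: C1M => //; apply: C1N; apply: C1M.
Qed.

Lemma differentiable_normalize x0 x : chart_domain x0 x ->
  differentiable (normalize x0) x.
Proof.
move=> /chart_domainP[a0 b0].
have RC := ring_class_differentiable x.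
have id_c := class_id x; have cst_c := class_coords_cst RC x0.
have aR := class_aaRe RC id_c cst_c; have aI := class_aaIm RC id_c cst_c.
have bR := class_baRe RC id_c cst_c; have bI := class_baIm RC id_c cst_c.
have bb := class_bbRe RC id_c cst_c.
have cR := class_abRe RC id_c cst_c; have cI := class_abIm RC id_c cst_c.
have dV (f : 'rV[R]_N -> R) : f x != 0 -> differentiable f x ->
  differentiable (fun y => (f y)^-1) x by move=> f0 df; exact: differentiableV.
have dSq : differentiable (fun y => (aaSq x0 y)^-1) x.
  apply: dV; first by rewrite /aaSq gt_eqF// ltr_pwDl ?sqr_ge0// exprn_gt0.
  by apply: (class_add RC); apply: (class_sqr RC).
have d1 : differentiable (proj_re x0) x.
  apply: (class_mul RC); last exact: dSq.
  by apply: (class_add RC); apply: (class_mul RC).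
have d2 : differentiable (proj_im x0) x.
  apply: (class_mul RC); last exact: dSq.
  by apply: (class_sub RC); apply: (class_mul RC).
have dr : differentiable (fun y => (bbRest x0 y)^-1) x.
  apply: dV; first exact: lt0r_neq0.
  by apply: (class_sub RC); [apply: (class_sub RC)|]; first exact: bb;
    apply: (class_mul RC).
apply: differentiable_rV; apply: (class_act RC).
- exact: id_c.
- by apply: dV; [exact: lt0r_neq0|exact: aR].
- exact: dr.
- by apply: (class_mul RC); [exact: (class_opp RC)|exact: dr].
- by apply: (class_mul RC); [exact: (class_opp RC)|exact: dr].
Qed.

(** Gram-Schmidt maps the slice at [x0] to the Stiefel manifold, with inverse [normalize x0]. The
    subspace [V], stable under both, lets one argument serve the complex manifold and the two real
    ones. *)
Lemma stiefel_has_charts : has_charts m (@stiefel_set R n `&` V).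
Proof.
move=> x0 [Sx0 Vx0]; have [K [K' [KK' KE]]] := basis Sx0 Vx0.
have n0 : normalized x0 x0 by case: Sx0.
have nK u : normalized x0 (x0 + u *m K).
  by apply: normalizedD => //; have /KE[] : exists v, u *m K = v *m K by exists u.
have VK u : V (x0 + u *m K).
  by apply: VD => //; have /KE[] : exists v, u *m K = v *m K by exists u.
have [phi lphi Mphi] : exists2 phi : 'rV[R]_m -> 'rV[R]_N,
    local_parametrization (@stiefel_set R n `&` V) setT phi &
    (@stiefel_set R n `&` V) `&` chart_domain x0 `<=` phi @` setT.
  apply: (local_parametrization_section (x0 := x0) (G := @gram_schmidt R n)
    (h := normalize x0) KK').
  - exact: open_chart_domain.
  - apply: C1_gram_schmidt => u; first exact: normalized_aa_gt0 (nK u).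
    exact: normalized_gram_gt0 (nK u).
  - exact: differentiable_normalize.
  - move=> u; have a0 := normalized_aa_gt0 (nK u).
    have g0 := normalized_gram_gt0 (nK u).
    have sa0 : 0 < (Num.sqrt (aaRe (x0 + u *m K) (x0 + u *m K)))^-1.
      by rewrite invr_gt0 sqrtr_gt0.
    have sg0 : 0 < (Num.sqrt (gram (x0 + u *m K)))^-1 by rewrite invr_gt0 sqrtr_gt0.
    split.
    + by split; [exact: gram_schmidt_stiefel|exact: VG].
    + apply/chart_domainP; split.
        by rewrite aaRe_act; case: (nK u) => -> *; rewrite mulr1.
      have [_ _ ->] // := normalize_act (Num.sqrt (gram (x0 + u *m K)))^-1
        (- (baRe (x0 + u *m K) (x0 + u *m K) / aaRe (x0 + u *m K) (x0 + u *m K)) /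
          Num.sqrt (gram (x0 + u *m K)))
        (- (baIm (x0 + u *m K) (x0 + u *m K) / aaRe (x0 + u *m K) (x0 + u *m K)) /
          Num.sqrt (gram (x0 + u *m K))) (lt0r_neq0 sa0) (nK u).
    + by apply: normalizeK => //; exact: lt0r_neq0.
  - move=> x [Sx Vx] /chart_domainP[a0 b0].
    have nx : normalized x0 (normalize x0 x).
      by apply: normalizedP; exact: lt0r_neq0.
    have /KE[u uE] : V (normalize x0 x - x0) /\
        [/\ aaRe (normalize x0 x - x0) x0 = 0, bbRe (normalize x0 x - x0) x0 = 0,
            baRe (normalize x0 x - x0) x0 = 0 & baIm (normalize x0 x - x0) x0 = 0].
      by split; [apply: VB => //; exact: VN|exact: normalizedB].
    exists u; first by rewrite -uE addrC subrK.
    by apply: gram_schmidtK => //; rewrite invr_gt0.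
exists setT, phi; split => //; apply: Mphi; split => //.
apply/chart_domainP.
(* [x0] lies in its own chart domain, being [act 1 1 0 0 x0]. *)
have := normalize_act 1 0 0 (oner_neq0 R) n0; rewrite act1 => -[_ _ ->].
by case: n0 => -> *; rewrite ltr01.
Qed.

End stiefel_charts.
End model_charts.

(** * Charts of spheres in linear subspaces *)

Section sphere_charts.
Context (R : realType) (n m : nat) (V : set 'rV[R]_(n * 4)).
Notation N := (n * 4)%N.
Implicit Types x y : 'rV[R]_N.
Hypothesis VD : forall x y, V x -> V y -> V (x + y).
Hypothesis VZ : forall a x, V x -> V (a *: x).

Definition dot x y : R := csum 0 0 x y + csum 1 1 x y + csum 2 2 x y + csum 3 3 x y.

Lemma dotDl x y z : dot (x + y) z = dot x z + dot y z.
Proof. by rewrite /dot !csumDl; ring. Qed.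

Lemma dotZl a x z : dot (a *: x) z = a * dot x z.
Proof. by rewrite /dot !csumZl; ring. Qed.

Lemma dotZr a x z : dot z (a *: x) = a * dot z x.
Proof. by rewrite /dot !csumZr; ring. Qed.

Lemma dot_gt0 x y : dot x y != 0 -> 0 < dot x x.
Proof.
move=> xy; rewrite lt_neqAle eq_sym /dot !addr_ge0 ?csum_ge0// andbT.
apply: contra xy => xx.
have : [&& csum 0 0 x x == 0, csum 1 1 x x == 0, csum 2 2 x x == 0 & csum 3 3 x x == 0].
  by move: xx; rewrite !paddr_eq0 ?addr_ge0 ?csum_ge0// !andbA.
move=> /and4P[/eqP/csum_eq0 h0 /eqP/csum_eq0 h1 /eqP/csum_eq0 h2 /eqP/csum_eq0 h3].
by apply/eqP; rewrite /dot !csum_zerol ?addr0.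
Qed.

Lemma class_dot (T : Type) (P : (T -> R) -> Prop) (y z : T -> 'rV[R]_N) :
  ring_class P -> class_coords P y -> class_coords P z ->
  P (fun t => dot (y t) (z t)).
Proof.
by move=> PC Py Pz; do !apply: (class_add PC); apply: (class_S PC).
Qed.

Hypothesis basis : forall x0, sphere_set x0 -> V x0 ->
  has_basis m [set y | V y /\ dot y x0 = 0].

(** The slice is the affine tangent space [dot y x0 = 2] within [V]; [G] and [h] move points along
    rays from the origin and are inverse to each other over the open hemisphere [W]. *)
Lemma sphere_has_charts : has_charts m (@sphere_set R n `&` V).
Proof.
move=> x0 [Sx0 Vx0]; have [K [K' [KK' KE]]] := basis Sx0 Vx0.
have K0 u : V (u *m K) /\ dot (u *m K) x0 = 0.
  by have /KE : exists v, u *m K = v *m K by exists u.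
have dK u : dot (x0 + u *m K) x0 = 2.
  by rewrite dotDl (K0 u).2 addr0.
have dK0 u : 0 < dot (x0 + u *m K) (x0 + u *m K).
  by apply: (@dot_gt0 _ x0); rewrite dK pnatr_eq0.
pose G y := (Num.sqrt 2 / Num.sqrt (dot y y)) *: y.
pose h x := (2 / dot x x0) *: x.
have s2 : 0 < Num.sqrt 2 :> R by rewrite sqrtr_gt0.
pose W := [set x | 0 < dot x x0].
have [phi lphi Mphi] : exists2 phi : 'rV[R]_m -> 'rV[R]_N,
    local_parametrization (@sphere_set R n `&` V) setT phi &
    (@sphere_set R n `&` V) `&` W `<=` phi @` setT.
  apply: (local_parametrization_section (x0 := x0) (G := G) (h := h) KK').
  - apply: open_positive; have RC := ring_class_continuous R 'rV[R]_N.
    exact: (class_dot RC (@class_id_continuous R n) (class_coords_cst RC x0)).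
  - have RC := ring_class_C1 R m; have aff := class_affine K x0.
    have C1d := class_dot RC aff aff.
    move=> j; rewrite /G.
    rewrite (_ : (fun u => _) = fun u : 'rV[R]_m => Num.sqrt 2 *
      (Num.sqrt (dot (x0 + u *m K) (x0 + u *m K)))^-1 * (x0 + u *m K) 0 j); last first.
      by apply/funext => u; rewrite mxE.
    apply: C1M; last exact: aff.
    apply: C1M; first exact: C1_cst.
    apply: C1V; last exact: C1_sqrt.
    by move=> u; rewrite sqrtr_eq0 -ltNge.
  - move=> x Wx; have RC := ring_class_differentiable x.
    apply: differentiable_rV => j.
    rewrite /h (_ : (fun u => _) = fun u => 2 * (dot u x0)^-1 * u 0 j); last first.
      by apply/funext => u; rewrite mxE.
    apply: (class_mul RC); last exact: class_id.
    apply: (class_mul RC); first exact: (class_cst RC 2).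
    apply: differentiableV; last exact: lt0r_neq0.
    exact: (class_dot RC (class_id x) (class_coords_cst RC x0)).
  - move=> u; have sd : 0 < Num.sqrt (dot (x0 + u *m K) (x0 + u *m K)).
      by rewrite sqrtr_gt0.
    split.
    + split; last by apply: VZ; apply: VD => //; exact: (K0 u).1.
      rewrite /sphere_set /= -/(dot _ _) /G dotZl dotZr -{3}(sqr_sqrtr (ltW (dK0 u))).
      rewrite -[RHS](@sqr_sqrtr _ 2)//.
      by field; exact: lt0r_neq0.
    + by rewrite /W /= /G dotZl dK mulr_gt0// divr_gt0.
    + rewrite /h /G dotZl dK scalerA -[RHS]scale1r; congr (_ *: _).
      by field; rewrite !lt0r_neq0.
  - move=> x [Sx Vx] Wx; have xn : dot x x0 != 0 by exact: lt0r_neq0.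
    have /KE[u uE] : V (h x - x0) /\ dot (h x - x0) x0 = 0.
      rewrite -[- x0]scaleN1r; split; first by apply: VD; exact: VZ.
      rewrite dotDl !dotZl [dot x0 x0]Sx0.
      by field.
    exists u; first by rewrite -uE addrC subrK.
    have c0 : 0 < 2 / dot x x0 by rewrite divr_gt0.
    rewrite /G /h dotZl dotZr [dot x x]Sx mulrA -expr2 sqrtrM ?sqr_ge0//.
    rewrite sqrtr_sqr gtr0_norm// scalerA -[RHS]scale1r; congr (_ *: _).
    by field; rewrite xn !lt0r_neq0.
exists setT, phi; split => //; apply: Mphi; split => //.
by rewrite /W /= [dot x0 x0]Sx0.
Qed.

End sphere_charts.

(** * Bases of the direction spaces of the slices *)

Section bases.
Context (R : realType) (n : nat).
Notation N := (n * 4)%N.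
Implicit Types x y : 'rV[R]_N.

(** Used with (1, 3), for R + jR, and with (0, 2), for iR + kR: the two components of the planar
    models. *)
Definition coord_zero (i j : nat) : set 'rV[R]_N :=
  [set x | forall l, co x i l = 0 /\ co x j l = 0].

Lemma has_basis_kernel m c (A L : 'M[R]_(c, N)) : L *m A^T = 1%:M ->
  (m + c = N)%N -> has_basis m [set y | y *m A^T = 0].
Proof.
by move=> LA mc; have [K [K' [KK' KE]]] := row_basis_kernel LA mc; exists K, K'.
Qed.

Section coordinate_subspace.
Context (i j : nat).
Hypotheses (i4 : (i < 4)%N) (j4 : (j < 4)%N) (ij : i != j).

Definition pick_fun x : 'rV[R]_(n * 2) :=
  mxvec (\matrix_(l < n, c < 2) co x (if c == 0 then i else j) l).

Lemma pick_fun_linear : linear pick_fun.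
Proof.
move=> a x y; rewrite /pick_fun -linearZ -linearD; congr mxvec.
by apply/matrixP => l c; rewrite !mxE coD coZ.
Qed.

Definition put_fun (w : 'rV[R]_(n * 2)) : 'rV[R]_N :=
  mxvec (\matrix_(l < n, c < 4) if c == i :> nat then w 0 (mxvec_index l 0)
    else if c == j :> nat then w 0 (mxvec_index l 1) else 0).

Lemma put_fun_linear : linear put_fun.
Proof.
move=> a x y; rewrite /put_fun -linearZ -linearD; congr mxvec.
apply/matrixP => l c; rewrite !mxE; case: eqP => // _; case: eqP => // _.
by rewrite mulr0 addr0.
Qed.

Lemma put_funK w : pick_fun (put_fun w) = w.
Proof.
apply/rowP => k; case/mxvec_indexP: k => l c.
rewrite /pick_fun mxvecE mxE coE /put_fun mxvecE mxE.
case: c => -[|[|//]] c2; rewrite /= inordK// eqxx ?(eq_sym j) ?(negbTE ij);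
  by congr (w 0 (mxvec_index l _)); exact/val_inj.
Qed.

Lemma exists_pick : exists (B : 'M[R]_(N, n * 2)) (C : 'M[R]_(n * 2, N)),
  C *m B = 1%:M /\ forall y, y *m B = 0 <-> coord_zero i j y.
Proof.
pose fM := GRing.isLinear.Build _ _ _ _ pick_fun pick_fun_linear.
pose F : {linear 'rV[R]_N -> 'rV[R]_(n * 2)} := HB.pack pick_fun fM.
pose gM := GRing.isLinear.Build _ _ _ _ put_fun put_fun_linear.
pose G : {linear 'rV[R]_(n * 2) -> 'rV[R]_N} := HB.pack put_fun gM.
exists (lin1_mx F), (lin1_mx G); split.
  apply/row_matrixP => k; rewrite row_mul [in LHS]rowE !mul_rV_lin1 row1.
  exact: put_funK.
move=> y; rewrite mul_rV_lin1 /= /pick_fun; split.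
  move=> /(congr1 vec_mx); rewrite mxvecK linear0 => /matrixP y0 l.
  by have := y0 l 0; have := y0 l 1; rewrite !mxE.
move=> y0; rewrite -[RHS](linear0 mxvec); congr mxvec; apply/matrixP => l c.
by rewrite !mxE; have [h0 h1] := y0 l; case: ifP.
Qed.

(* The rows of A lie in the coordinate subspace, which makes the system given
   by A and the vanishing coordinates block triangular. *)
Lemma has_basis_coord_zero m c (A L : 'M[R]_(c, N)) : L *m A^T = 1%:M ->
  (forall k, coord_zero i j (row k L)) ->
  (m + (c + n * 2) = N)%N ->
  has_basis m [set y | coord_zero i j y /\ y *m A^T = 0].
Proof.
move=> LA LZ mc; have [B [C [CB BE]]] := exists_pick.
have LB : L *m B = 0.
  by apply/row_matrixP => k; rewrite row_mul row0; exact/BE.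
(* Since [L *m B = 0], the only off-diagonal block comes from [C *m A^T]; subtracting
   [C *m A^T *m L] from [C] clears it. *)
have e : col_mx L (C - C *m A^T *m L) *m row_mx A^T B = 1%:M.
  rewrite mul_col_row LA LB !mulmxBl CB -!mulmxA LA LB !mulmx0 mulmx1 subrr subr0.
  by rewrite -scalar_mx_block.
have [K [K' [KK' KE]]] := row_basis_kernel e mc.
exists K, K'; split => // y; rewrite -KE mul_mx_row -row_mx0.
by split=> [[/BE yB yA]|/eq_row_mx[yA /BE yB]]; [rewrite yA yB|].
Qed.

End coordinate_subspace.

End bases.

(** * Compactness, dimension and charts of the four model spaces *)

Section models.
Context (R : realType) (n : nat).
Notation N := (n * 4)%N.
Implicit Types x y : 'rV[R]_N.

Lemma sphere_dot x : sphere_set x <-> dot x x = 2. Proof. by []. Qed.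

Lemma continuous_dot_diag : continuous (fun x => dot x x).
Proof.
have RC := ring_class_continuous R 'rV[R]_N; have ic := @class_id_continuous R n.
exact: (class_dot RC ic ic).
Qed.

Lemma closed_eq_continuous (T : topologicalType) (f : T -> R) c :
  continuous f -> closed [set x | f x = c].
Proof.
move=> cf; apply: (@preimage_closed _ _ f [set c]).
  by move=> x _; exact: cf.
by apply: compact_closed; [exact: norm_hausdorff|exact: compact_set1].
Qed.

Lemma compact_sphere : compact (@sphere_set R n).
Proof.
apply: bounded_closed_compact; last exact: closed_eq_continuous continuous_dot_diag.
(* A coordinate has square at most 2, hence at most [2 ^+ 2]; this crude bound avoids the square
   root of 2. *)
exists 2; split; first exact: num_real.
move=> r r2 x Sx /=; rewrite [leLHS]/Num.norm /= mx_normrE.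
apply: bigmax_le => [|[i j] _ /=]; first by apply: ltW; apply: lt_trans r2.
rewrite ord1; apply: le_trans (ltW r2).
rewrite -(@ler_pXn2r _ 2)// ?nnegrE// real_normK ?num_real//.
have -> : x 0 j ^+ 2 = dot x x - \sum_(k | k != j) x 0 k ^+ 2.
  rewrite /dot -dotE mxE (bigD1 j)//= mxE -expr2.
  rewrite [X in _ + X - _](_ : _ = \sum_(k | k != j) x 0 k ^+ 2) ?addrK//.
  by apply: eq_bigr => k _; rewrite mxE expr2.
rewrite [dot x x]Sx lerBlDr -[leLHS]addr0 lerD//; last first.
  by apply: sumr_ge0 => k _; rewrite sqr_ge0.
by rewrite expr2 -natrM ler_nat.
Qed.

Lemma closed_sphere : closed (@sphere_set R n).
Proof. exact: closed_eq_continuous continuous_dot_diag. Qed.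

Lemma closed_coord_zero i j : closed (@coord_zero R n i j).
Proof.
have RC := ring_class_continuous R 'rV[R]_N; have ic := @class_id_continuous R n.
have -> : coord_zero i j = \bigcap_(l in [set: 'I_n])
    ([set x | co x i l = 0] `&` [set x : 'rV[R]_N | co x j l = 0]).
  by apply/seteqP; split => x h l; [move=> _; exact: h|exact: h].
by apply: closed_bigI => l _; apply: closedI;
  apply: closed_eq_continuous; exact: (class_co ic).
Qed.

Lemma stiefel_sphere : @stiefel_set R n `<=` @sphere_set R n.
Proof.
move=> x [a b _ _]; rewrite /sphere_set /=.
transitivity (aaRe x x + bbRe x x); first by rewrite /aaRe /bbRe; ring.
by rewrite a b.
Qed.

Lemma closed_stiefel : closed (@stiefel_set R n).
Proof.
have RC := ring_class_continuous R 'rV[R]_N; have ic := @class_id_continuous R n.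
have -> : @stiefel_set R n = [set x | aaRe x x = 1] `&` [set x | bbRe x x = 1] `&`
   ([set x | baRe x x = 0] `&` [set x | baIm x x = 0]).
  by apply/seteqP; split => x; [move=> [? ? ? ?]|move=> [[? ?] [? ?]]].
apply: closedI; apply: closedI; apply: closed_eq_continuous.
- exact: (class_aaRe RC ic ic).
- exact: (class_bbRe RC ic ic).
- exact: (class_baRe RC ic ic).
- exact: (class_baIm RC ic ic).
Qed.

Lemma dot_mulmx (y x : 'rV[R]_N) : (y *m x^T == 0) = (dot y x == 0).
Proof.
rewrite [y *m x^T]mx11_scalar dotE -/(dot y x).
by apply/eqP/eqP => [/matrixP/(_ 0 0)|->]; rewrite ?raddf0// !mxE eqxx mulr1n.
Qed.

Lemma half_sphere_gram x : sphere_set x -> (2^-1 *: x) *m x^T = 1%:M.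
Proof.
move=> Sx; rewrite -scalemxAl [x *m x^T]mx11_scalar dotE.
by rewrite -/(dot x x) [dot x x]Sx scale_scalar_mx mulVf// pnatr_eq0.
Qed.

Lemma sphere_charts_full : (0 < n)%N -> has_charts (4 * n - 1) (@sphere_set R n).
Proof.
move=> n0; rewrite -[sphere_set (n := n)]setIT; apply: sphere_has_charts => // x Sx _.
rewrite (_ : [set y | _] = [set y | y *m x^T = 0]).
  by apply: has_basis_kernel (half_sphere_gram Sx) _; lia.
apply/seteqP; split => y /=; first by move=> [_ /eqP]; rewrite -dot_mulmx => /eqP.
by move=> /eqP; rewrite dot_mulmx => /eqP.
Qed.

(** With x = (a, b), the vectors (a, 0), (0, b), (0, a) and (0, ia), which represent the linear
    forms [aaRe], [bbRe], [baRe] and [baIm] against [x]. They are orthonormal when [x] is on the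
    Stiefel manifold. *)
Definition frame x (k : nat) :=
  act (k == 0)%:R (k == 1)%:R (k == 2)%:R (k == 3)%:R x.

Definition frame_mx c x : 'M[R]_(c, N) := \matrix_(k < c) frame x k.

Lemma dot_act y s t c1 c2 x : dot y (act s t c1 c2 x) =
  s * aaRe y x + t * bbRe y x + c1 * baRe y x + c2 * baIm y x.
Proof. by rewrite /dot /aaRe /bbRe /baRe /baIm !csum_act; ring. Qed.

Lemma mulmx_frame c y x (k : 'I_c) : (y *m (frame_mx c x)^T) 0 k = dot y (frame x k).
Proof.
rewrite /dot -dotE !mxE; apply: eq_bigr => l _; rewrite !mxE.
by [].
Qed.

Lemma frame_gram c x : (c <= 4)%N -> stiefel_set x ->
  frame_mx c x *m (frame_mx c x)^T = 1%:M.
Proof.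
move=> c4 [a1 b1 r0 i0]; apply/matrixP => k k'.
have -> : (frame_mx c x *m (frame_mx c x)^T) k k' =
    (frame x k *m (frame_mx c x)^T) 0 k'.
  by rewrite !mxE; apply: eq_bigr => l _; rewrite !mxE.
have k4 : (k < 4)%N by exact: leq_trans (ltn_ord k) c4.
have k4' : (k' < 4)%N by exact: leq_trans (ltn_ord k') c4.
rewrite mulmx_frame mxE -val_eqE /= /frame dot_act.
rewrite aaRe_act bbRe_act baRe_act baIm_act a1 b1 r0 i0.
have -> : abRe x x = 0.
  by rewrite -r0 /abRe /baRe (csum_sym 0) (csum_sym 1).
have -> : abIm x x = 0.
  by rewrite -i0 /abIm /baIm (csum_sym 0) (csum_sym 1).
have -> : aaIm x x = 0 by rewrite /aaIm (csum_sym 0) subrr.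
move: k4 k4'; move: (nat_of_ord k) (nat_of_ord k') => p q.
by case: p => [|[|[|[|//]]]] _; case: q => [|[|[|[|//]]]] _ /=; ring.
Qed.

Lemma dot_frame y x : [/\ dot y (frame x 0) = aaRe y x,
  dot y (frame x 1) = bbRe y x, dot y (frame x 2) = baRe y x &
  dot y (frame x 3) = baIm y x].
Proof. by split; rewrite /frame dot_act /=; ring. Qed.

Lemma mulmx_frame_eq0 c y x : y *m (frame_mx c x)^T = 0 <->
  forall k, (k < c)%N -> dot y (frame x k) = 0.
Proof.
split=> [y0 k kc|y0].
  by rewrite -(mulmx_frame _ _ (Ordinal kc)) y0 mxE.
by apply/rowP => k; rewrite mulmx_frame mxE; exact: y0.
Qed.

Lemma stiefel_charts_full : (1 < n)%N -> has_charts (4 * n - 4) (@stiefel_set R n).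
Proof.
move=> n1; rewrite -[stiefel_set (n := n)]setIT; apply: stiefel_has_charts => // x Sx _.
rewrite (_ : [set y | _] = [set y | y *m (frame_mx 4 x)^T = 0]).
  by apply: has_basis_kernel (frame_gram (leqnn 4) Sx) _; lia.
apply/seteqP; split => y /=; have [h0 h1 h2 h3] := dot_frame y x.
  move=> [_ [a b c d]]; apply/mulmx_frame_eq0.
  by move=> [|[|[|[|//]]]] _; rewrite ?h0 ?h1 ?h2 ?h3.
move/mulmx_frame_eq0 => y0; split=> //.
by split; rewrite -?h0 -?h1 -?h2 -?h3; exact: y0.
Qed.

Section real_models.
Context (i j : nat).
Hypothesis hij : (i, j) = (1%N, 3%N) \/ (i, j) = (0%N, 2%N).

Let hij4 : [/\ (i < 4)%N, (j < 4)%N & i != j].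
Proof. by case: hij => -[-> ->]. Qed.

Lemma coord_zeroD x y : coord_zero i j x -> coord_zero i j y -> coord_zero i j (x + y).
Proof.
by move=> hx hy l; have [? ?] := hx l; have [? ?] := hy l; rewrite !coD; split; lra.
Qed.

Lemma coord_zeroZ a x : coord_zero i j x -> coord_zero i j (a *: x).
Proof. by move=> hx l; rewrite !coZ (hx l).1 (hx l).2 mulr0. Qed.

Lemma sphere_charts_real : (0 < n)%N ->
  has_charts (2 * n - 1) (@sphere_set R n `&` coord_zero i j).
Proof.
move=> n0; have [i4 j4 ij] := hij4.
apply: sphere_has_charts => [x y|a x|x Sx Zx].
- exact: coord_zeroD.
- exact: coord_zeroZ.
- rewrite (_ : [set y | _] = [set y | coord_zero i j y /\ y *m x^T = 0]).
    apply: (has_basis_coord_zero i4 j4 ij (half_sphere_gram Sx)); last by lia.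
    by move=> k; rewrite row_id; exact: coord_zeroZ.
  apply/seteqP; split => y /= [Zy /eqP]; first by rewrite -dot_mulmx => /eqP.
  by rewrite dot_mulmx => /eqP.
Qed.

Lemma coord_zero_Im x y : coord_zero i j x -> coord_zero i j y ->
  baIm x y = 0 /\ aaIm x y = 0.
Proof.
case: hij => -[-> ->] hx hy; rewrite /baIm /aaIm.
  have x1 l := (hx l).1; have x3 l := (hx l).2.
  have y1 l := (hy l).1; have y3 l := (hy l).2.
  by rewrite (csum_zerol _ _ x3) (csum_zeror _ _ y1) (csum_zerol _ _ x1) (csum_zeror _ _ y1) subr0.
have x1 l := (hx l).1; have x3 l := (hx l).2.
have y1 l := (hy l).1; have y3 l := (hy l).2.
by rewrite (csum_zeror _ _ y1) (csum_zerol _ _ x3) (csum_zeror _ _ y1) (csum_zerol _ _ x1) subr0.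
Qed.

Lemma coord_zero_act s t c1 x : coord_zero i j x -> coord_zero i j (act s t c1 0 x).
Proof.
case: hij => -[-> ->] hx l; rewrite !co_act//=; have [-> ->] := hx l;
  by split; ring.
Qed.

(** On the coordinate subspace the form [baIm] vanishes identically, so three of the four frame
    vectors give all equations, and the slice has dimension 4n - 2n - 3. *)
Lemma stiefel_charts_real : (1 < n)%N ->
  has_charts (2 * n - 3) (@stiefel_set R n `&` coord_zero i j).
Proof.
move=> n1; have [i4 j4 ij] := hij4.
apply: stiefel_has_charts => [x y|x y Zx Zy|x Zx|x0 x Zx0 Zx|x Sx Zx].
- exact: coord_zeroD.
- by rewrite -scaleN1r; apply: coord_zeroD => //; exact: coord_zeroZ.
- rewrite /gram_schmidt; have [-> _] := coord_zero_Im Zx Zx.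
  by rewrite !(mul0r, oppr0); exact: coord_zero_act.
- rewrite /normalize /proj_im; have [-> ->] := coord_zero_Im Zx Zx0.
  by rewrite !(mul0r, mulr0, oppr0, subr0); exact: coord_zero_act.
- rewrite (_ : [set y | _] =
      [set y | coord_zero i j y /\ y *m (frame_mx 3 x)^T = 0]).
    have le34 : (3 <= 4)%N by [].
    apply: (has_basis_coord_zero i4 j4 ij (frame_gram le34 Sx)); last by lia.
    move=> k; rewrite rowK /frame.
    (* The first three frame vectors involve no multiplication by i, so they stay in the coordinate
       subspace. *)
    have -> : (k == 3 :> nat) = false by case: k => -[|[|[|]]].
    exact: coord_zero_act.
  apply/seteqP; split => y /=; have [h0 h1 h2 h3] := dot_frame y x.
    move=> [Zy [a b c d]]; split=> //; apply/mulmx_frame_eq0.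
    by move=> [|[|[|//]]] _; rewrite ?h0 ?h1 ?h2.
  move=> [Zy /mulmx_frame_eq0 y0]; split=> //.
  by split; [rewrite -h0|rewrite -h1|rewrite -h2|have [] := coord_zero_Im Zy Zx];
    rewrite ?y0.
Qed.

End real_models.

Definition real_model (X : set 'rV[R]_N) :=
  (X `&` coord_zero 1 3) `|` (X `&` coord_zero 0 2).

(** The two pieces are disjoint: a common point would have all coordinates zero, whereas [X] lies on
    the sphere. *)
Lemma real_model_charts m (X : set 'rV[R]_N) :
  closed X -> X `<=` @sphere_set R n ->
  has_charts m (X `&` coord_zero 1 3) -> has_charts m (X `&` coord_zero 0 2) ->
  has_charts m (real_model X).
Proof.
move=> cX SX; apply: has_chartsU.
- by apply: closedI => //; exact: closed_coord_zero.
- by apply: closedI => //; exact: closed_coord_zero.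
- apply/seteqP; split => // x [[/SX Sx h] [_ h']].
  have h1 l := (h l).1; have h3 l := (h l).2.
  have h0 l := (h' l).1; have h2 l := (h' l).2.
  move: Sx; rewrite /sphere_set /= (csum_zerol _ _ h0) (csum_zerol _ _ h1).
  by rewrite (csum_zerol _ _ h2) (csum_zerol _ _ h3); lra.
Qed.

Lemma closed_real_model X : closed X -> closed (real_model X).
Proof.
by move=> cX; apply: closedU; apply: closedI => //; exact: closed_coord_zero.
Qed.

Lemma real_model_sub X : real_model X `<=` X.
Proof. by move=> x [[]|[]]. Qed.

End models.

(** * The models expressed by real equations in the coordinates *)

Section model_identification.
Context (R : realType) (n : nat).
Notation N := (n * 4)%N.
Implicit Types x y : 'rV[R]_N.

Lemma enorm_sphere x : enorm x = Num.sqrt 2 <-> sphere_set x.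
Proof.
rewrite /sphere_set /= -enorm_sqr; split=> [->|x2]; first by rewrite sqr_sqrtr.
by rewrite -x2 sqrtr_sqr ger0_norm// sqrtr_ge0.
Qed.

Lemma arm_model3E : @arm_model3 R n = @sphere_set R n.
Proof. by apply/seteqP; split => x /enorm_sphere. Qed.

Lemma arm_model2E : @arm_model2 R n = real_model (@sphere_set R n).
Proof. by apply/seteqP; split => x [[/enorm_sphere]|[/enorm_sphere]]; [left|right|left|right]. Qed.

Lemma co_quat_of_pair (a b : 'cV[R[i]]_n) c l : (c < 4)%N ->
  co (quat_of_pair a b) c l =
  [:: complex.Re (a l 0); complex.Im (a l 0); complex.Re (b l 0); complex.Im (b l 0)]`_c.
Proof.
move=> c4; have qcD (p q : 'rV[R]_4) : qc (p + q) c = qc p c + qc q c.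
  by rewrite /qc mxE.
rewrite /quat_of_pair co_mxvec qcD /qmul /quat_of_complex /qj !qc_mkquat// {qcD}.
by case: c c4 => [|[|[|[|]]]] //= _; ring.
Qed.

Lemma complex_sum1 (f : 'I_n -> R[i]) (r : R) : \sum_l f l = r%:C%C <->
  \sum_l complex.Re (f l) = r /\ \sum_l complex.Im (f l) = 0.
Proof.
have reS : complex.Re (\sum_l f l) = \sum_l complex.Re (f l).
  by apply: (big_morph (@complex.Re R)) => // -[? ?] [].
have imS : complex.Im (\sum_l f l) = \sum_l complex.Im (f l).
  by apply: (big_morph (@complex.Im R)) => // -[? ?] [].
rewrite -reS -imS; split=> [->//|[re im]].
by apply/eqP; rewrite eq_complex re im /= !eqxx.
Qed.

(** [stiefelC] annihilates <a, b> and [stiefel_set] its conjugate <b, a>, which accounts for the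
    sign changes in the imaginary parts. *)
Lemma stiefelC_set a b : stiefelC (n := n) (a, b) <-> stiefel_set (@quat_of_pair R n a b).
Proof.
rewrite /stiefelC /stiefel_set /=.
have reE (z w : R[i]) : complex.Re (z * conjc w) =
    complex.Re z * complex.Re w + complex.Im z * complex.Im w.
  by case: z w => ? ? [? ?] /=; ring.
have imE (z w : R[i]) : complex.Im (z * conjc w) =
    complex.Im z * complex.Re w - complex.Re z * complex.Im w.
  by case: z w => ? ? [? ?] /=; ring.
have sumRe (u v : 'cV[R[i]]_n) : \sum_l complex.Re (u l 0 * conjc (v l 0)) =
    \sum_l complex.Re (u l 0) * complex.Re (v l 0) +
    \sum_l complex.Im (u l 0) * complex.Im (v l 0).
  by rewrite -big_split; apply: eq_bigr => l _; rewrite reE.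
have sumIm (u v : 'cV[R[i]]_n) : \sum_l complex.Im (u l 0 * conjc (v l 0)) =
    \sum_l complex.Im (u l 0) * complex.Re (v l 0) -
    \sum_l complex.Re (u l 0) * complex.Im (v l 0).
  by rewrite -sumrB; apply: eq_bigr => l _; rewrite imE.
have SE i j : (i < 4)%N -> (j < 4)%N ->
  csum i j (quat_of_pair a b) (quat_of_pair a b) =
  \sum_l [:: complex.Re (a l 0); complex.Im (a l 0); complex.Re (b l 0); complex.Im (b l 0)]`_i
   * [:: complex.Re (a l 0); complex.Im (a l 0); complex.Re (b l 0); complex.Im (b l 0)]`_j.
  by move=> i4 j4; apply: eq_bigr => l _; rewrite !co_quat_of_pair.
rewrite /aaRe /bbRe /baRe /baIm (csum_sym 2 0) (csum_sym 3 1) (csum_sym 3 0) (csum_sym 2 1) !SE//=.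
split=> [[/complex_sum1 + /complex_sum1 + /complex_sum1]|[h1 h2 h3 h4]].
  rewrite !sumRe !sumIm => -[h1 _] [h2 _] [h3 h4]; split => //.
  by rewrite -opprB h4 oppr0.
split; apply/complex_sum1; rewrite ?sumRe ?sumIm; split => //.
- by rewrite (eq_bigr _ (fun l _ => mulrC _ _)) subrr.
- by rewrite (eq_bigr _ (fun l _ => mulrC _ _)) subrr.
- by rewrite -opprB h4 oppr0.
Qed.

Lemma quat_of_pair_surj x : exists a b, x = @quat_of_pair R n a b.
Proof.
exists (\col_l (co x 0 l +i* co x 1 l)%C), (\col_l (co x 2 l +i* co x 3 l)%C).
apply: co_inj => c l c4; rewrite co_quat_of_pair// !mxE /=.
by case: c c4 => [|[|[|[|]]]].
Qed.

Lemma pol_model3E : @pol_model3 R n = @stiefel_set R n.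
Proof.
apply/seteqP; split => x.
  by move=> [[a b] h <-]; apply/stiefelC_set.
by have [a [b ->]] := quat_of_pair_surj x; move/stiefelC_set; exists (a, b).
Qed.

Lemma stiefel_real13 x : coord_zero 1 3 x ->
  stiefel_set x <-> [/\ csum 0 0 x x = 1, csum 2 2 x x = 1 & csum 0 2 x x = 0].
Proof.
move=> Zx; have x1 l := (Zx l).1; have x3 l := (Zx l).2.
rewrite /stiefel_set /= /aaRe /bbRe /baRe /baIm (csum_sym 2 0) (csum_zerol 1 _ x1).
rewrite !(csum_zerol _ _ x3) (csum_zeror 2 _ x1) !addr0.
by split=> [[? ? ? ?]|[? ? ?]]; split => //; rewrite subrr.
Qed.

Lemma stiefel_real02 x : coord_zero 0 2 x ->
  stiefel_set x <-> [/\ csum 1 1 x x = 1, csum 3 3 x x = 1 & csum 1 3 x x = 0].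
Proof.
move=> Zx; have x0 l := (Zx l).1; have x2 l := (Zx l).2.
rewrite /stiefel_set /= /aaRe /bbRe /baRe /baIm (csum_sym 3 1) (csum_zerol 0 _ x0).
rewrite !(csum_zerol _ _ x2) (csum_zeror 3 _ x0) !add0r.
by split=> [[? ? ? ?]|[? ? ?]]; split => //; rewrite oppr0.
Qed.

(** Since ia + (ib)j = ia + bk, the factor i puts the real vectors a and b in coordinates 1 and 3,
    which gives the piece [coord_zero 0 2]. *)
Lemma pol_model2E : @pol_model2 R n = real_model (@stiefel_set R n).
Proof.
apply/seteqP; split => x.
  case=> -[[a b] [/= ha hb hab] <-]; [left|right].
    have Z : coord_zero 1 3 (quat_of_pair (map_mx (real_complex R) a)
        (map_mx (real_complex R) b)).
      by move=> l; rewrite !co_quat_of_pair//= !mxE.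
    split=> //; apply/stiefel_real13 => //; split.
    - by rewrite -[RHS]ha; apply: eq_bigr => l _; rewrite !co_quat_of_pair//= !mxE.
    - by rewrite -[RHS]hb; apply: eq_bigr => l _; rewrite !co_quat_of_pair//= !mxE.
    - by rewrite -[RHS]hab; apply: eq_bigr => l _; rewrite !co_quat_of_pair//= !mxE.
  have Z : coord_zero 0 2 (quat_of_pair ('i%C *: map_mx (real_complex R) a)
      ('i%C *: map_mx (real_complex R) b)).
    by move=> l; rewrite !co_quat_of_pair//= !mxE /=; split; ring.
  split=> //; apply/stiefel_real02 => //; split.
  - by rewrite -[RHS]ha; apply: eq_bigr => l _; rewrite !co_quat_of_pair//= !mxE /=; ring.
  - by rewrite -[RHS]hb; apply: eq_bigr => l _; rewrite !co_quat_of_pair//= !mxE /=; ring.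
  - by rewrite -[RHS]hab; apply: eq_bigr => l _; rewrite !co_quat_of_pair//= !mxE /=; ring.
case=> -[Sx Zx]; [left|right].
  have [h0 h2 h02] := (stiefel_real13 Zx).1 Sx.
  exists (\col_l co x 0 l, \col_l co x 2 l).
    split=> /=; [rewrite -[RHS]h0|rewrite -[RHS]h2|rewrite -[RHS]h02]; by apply: eq_bigr => l _; rewrite !mxE.
  apply: co_inj => c l c4; rewrite co_quat_of_pair//= !mxE /=.
  by have [z1 z3] := Zx l; case: c c4 => [|[|[|[|]]]] //= _.
have [h0 h2 h02] := (stiefel_real02 Zx).1 Sx.
exists (\col_l co x 1 l, \col_l co x 3 l).
  split=> /=; [rewrite -[RHS]h0|rewrite -[RHS]h2|rewrite -[RHS]h02]; by apply: eq_bigr => l _; rewrite !mxE.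
apply: co_inj => c l c4; rewrite co_quat_of_pair//= !mxE /=.
have [z1 z3] := Zx l; case: c c4 => [|[|[|[|]]]] //= _; rewrite ?z1 ?z3; ring.
Qed.

End model_identification.

(** * Linear isometries preserving the models *)

Section symmetries.
Context (R : realType) (n : nat).
Notation N := (n * 4)%N.
Implicit Types (x y : 'rV[R]_N) (M : set 'rV[R]_N).

Record symmetry M (f : 'rV[R]_N -> 'rV[R]_N) : Prop := {
  symmetry_linear : linear f ;
  symmetry_dot : forall x y, dot (f x) (f y) = dot x y ;
  symmetry_stable : forall x, M (f x) <-> M x }.

Lemma symmetry_mx M f : symmetry M f ->
  exists2 T : 'M[R]_N, T *m T^T = 1%:M & forall x, f x = x *m T.
Proof.
case=> fL fdot _.
pose fM := GRing.isLinear.Build _ _ _ _ f fL.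
pose F : {linear 'rV[R]_N -> 'rV[R]_N} := HB.pack f fM.
have fE x : x *m lin1_mx F = f x by rewrite mul_rV_lin1.
exists (lin1_mx F) => //; apply/matrixP => i j.
transitivity (dot (delta_mx 0 i *m lin1_mx F) (delta_mx 0 j *m lin1_mx F)).
  rewrite /dot -dotE -!rowE !mxE; apply: eq_bigr => k _; rewrite !mxE.
  by [].
rewrite !fE fdot /dot -dotE !mxE (bigD1 i)//= big1 => [|k ki].
  by rewrite !mxE !eqxx addr0 /= mul1r.
by rewrite !mxE (negbTE ki) mul0r.
Qed.

Definition row_rot (p q : 'I_n) (c s : R) x : 'rV[R]_N :=
  mxvec (\matrix_(l < n)
    if l == p then c *: qcoord x p + s *: qcoord x q
    else if l == q then - s *: qcoord x p + c *: qcoord x q else qcoord x l).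

Lemma co_rot p q c s x k l : co (row_rot p q c s x) k l =
  if l == p then c * co x k p + s * co x k q
  else if l == q then - s * co x k p + c * co x k q else co x k l.
Proof. by rewrite co_mxvec /co /qc; case: eqP => _; [|case: eqP => _]; rewrite ?mxE. Qed.

(** The mixing coefficients are real, so each of the four coordinate vectors in R^n undergoes the
    same plane rotation. *)
Lemma csum_rot p q c s i j x y : p != q -> c ^+ 2 + s ^+ 2 = 1 ->
  csum i j (row_rot p q c s x) (row_rot p q c s y) = csum i j x y.
Proof.
move=> pq cs; rewrite /csum (bigD1 p)//= (bigD1 q) ?(eq_sym q)//=.
rewrite [RHS](bigD1 p)//= [in RHS](bigD1 q) ?(eq_sym q)//= !addrA.
rewrite !co_rot !eqxx (eq_sym q) (negbTE pq).
congr (_ + _).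
  transitivity ((c ^+ 2 + s ^+ 2) * (co x i p * co y j p + co x i q * co y j q)).
    by ring.
  by rewrite cs mul1r.
by apply: eq_bigr => l /andP[/negbTE lp /negbTE lq]; rewrite !co_rot lp lq.
Qed.

Lemma coord_zeroS i j x : coord_zero i j x <-> csum i i x x = 0 /\ csum j j x x = 0.
Proof.
split=> [h|[/csum_eq0 hi /csum_eq0 hj] l //].
by split; apply: csum_zerol => l; have [] := h l.
Qed.

Lemma rot_symmetry M p q c s : p != q -> c ^+ 2 + s ^+ 2 = 1 ->
  (forall x y, (forall i j, csum i j x x = csum i j y y) -> M x -> M y) ->
  symmetry M (row_rot p q c s).
Proof.
move=> pq cs MS; split.
- move=> a x y; apply: co_inj => k l _.
  by rewrite coD coZ !co_rot !coD !coZ; case: ifP => _; [|case: ifP => _]; ring.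
- by move=> x y; rewrite /dot !csum_rot.
- by move=> x; split; apply: MS => i j; rewrite csum_rot.
Qed.

Lemma sphere_S x y : (forall i j, csum i j x x = csum i j y y) ->
  sphere_set x -> sphere_set y.
Proof. by move=> xy; rewrite /sphere_set /= !xy. Qed.

Lemma stiefel_S x y : (forall i j, csum i j x x = csum i j y y) ->
  stiefel_set x -> stiefel_set y.
Proof. by move=> xy; rewrite /stiefel_set /= /aaRe /bbRe /baRe /baIm !xy. Qed.

Lemma real_model_S M : 
  (forall x y, (forall i j, csum i j x x = csum i j y y) -> M x -> M y) ->
  forall x y, (forall i j, csum i j x x = csum i j y y) ->
    real_model M x -> real_model M y.
Proof.
move=> MS x y xy [[Mx /coord_zeroS h]|[Mx /coord_zeroS h]]; [left|right];
  by split; [exact: MS Mx|apply/coord_zeroS; rewrite -!xy].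
Qed.

Definition lmul_i (p : 'I_n) x : 'rV[R]_N :=
  mxvec (\matrix_(l < n) if l == p then
    mkquat (- co x 1 l) (co x 0 l) (- co x 3 l) (co x 2 l) else qcoord x l).

Definition lmul_j (p : 'I_n) x : 'rV[R]_N :=
  mxvec (\matrix_(l < n) if l == p then
    mkquat (- co x 2 l) (co x 3 l) (co x 0 l) (- co x 1 l) else qcoord x l).

Lemma co_lmul_i p x k l : (k < 4)%N -> co (lmul_i p x) k l =
  if l == p then [:: - co x 1 l; co x 0 l; - co x 3 l; co x 2 l]`_k else co x k l.
Proof. by move=> k4; rewrite co_mxvec; case: ifP => // _; rewrite qc_mkquat. Qed.

Lemma co_lmul_j p x k l : (k < 4)%N -> co (lmul_j p x) k l =
  if l == p then [:: - co x 2 l; co x 3 l; co x 0 l; - co x 1 l]`_k else co x k l.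
Proof. by move=> k4; rewrite co_mxvec; case: ifP => // _; rewrite qc_mkquat. Qed.

Lemma lmul_i_linear p : linear (lmul_i p).
Proof.
move=> a x y; apply: co_inj => k l k4; rewrite coD coZ !co_lmul_i// !coD !coZ.
by case: ifP => // _; case: k k4 => [|[|[|[|//]]]] _ /=; ring.
Qed.

Lemma lmul_j_linear p : linear (lmul_j p).
Proof.
move=> a x y; apply: co_inj => k l k4; rewrite coD coZ !co_lmul_j// !coD !coZ.
by case: ifP => // _; case: k k4 => [|[|[|[|//]]]] _ /=; ring.
Qed.

Lemma dot_sum x y : dot x y = \sum_l (co x 0 l * co y 0 l + co x 1 l * co y 1 l +
  co x 2 l * co y 2 l + co x 3 l * co y 3 l).
Proof. by rewrite /dot /csum -!big_split. Qed.

Lemma lmul_i_dot p x y : dot (lmul_i p x) (lmul_i p y) = dot x y.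
Proof.
rewrite !dot_sum; apply: eq_bigr => l _; rewrite !co_lmul_i//.
by case: ifP => //= _; ring.
Qed.

Lemma lmul_j_dot p x y : dot (lmul_j p x) (lmul_j p y) = dot x y.
Proof.
rewrite !dot_sum; apply: eq_bigr => l _; rewrite !co_lmul_j//.
by case: ifP => //= _; ring.
Qed.

Lemma lmul_i_hermitian p x :
  [/\ aaRe (lmul_i p x) (lmul_i p x) = aaRe x x,
      bbRe (lmul_i p x) (lmul_i p x) = bbRe x x,
      baRe (lmul_i p x) (lmul_i p x) = baRe x x &
      baIm (lmul_i p x) (lmul_i p x) = baIm x x].
Proof.
rewrite /aaRe /bbRe /baRe /baIm /csum.
by split; rewrite -?sumrB -?big_split /= -?sumrB -?big_split;
  apply: eq_bigr => l _; rewrite !co_lmul_i//; case: ifP => //= _; ring.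
Qed.

Lemma lmul_i_sphere p : symmetry (@sphere_set R n) (lmul_i p).
Proof.
split; [exact: lmul_i_linear|exact: lmul_i_dot|move=> x].
by rewrite !sphere_dot lmul_i_dot.
Qed.

(** a_p and b_p are multiplied by the same unit complex number, so no Hermitian product changes. *)
Lemma lmul_i_stiefel p : symmetry (@stiefel_set R n) (lmul_i p).
Proof.
split; [exact: lmul_i_linear|exact: lmul_i_dot|move=> x].
by rewrite /stiefel_set /=; have [-> -> -> ->] := lmul_i_hermitian p x.
Qed.

Lemma lmul_j_sphere p : symmetry (@sphere_set R n) (lmul_j p).
Proof.
split; [exact: lmul_j_linear|exact: lmul_j_dot|move=> x].
by rewrite !sphere_dot lmul_j_dot.
Qed.

Lemma lmul_j_coord_zero p x :
  (coord_zero 1 3 (lmul_j p x) <-> coord_zero 1 3 x) /\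
  (coord_zero 0 2 (lmul_j p x) <-> coord_zero 0 2 x).
Proof.
split; split=> h l; have := h l; rewrite !co_lmul_j//; case: ifP => //= _ [h1 h2];
  split; lra.
Qed.

(** Left multiplication by j preserves each of the planes R + jR and iR + kR. *)
Lemma lmul_j_real_sphere p : symmetry (real_model (@sphere_set R n)) (lmul_j p).
Proof.
split; [exact: lmul_j_linear|exact: lmul_j_dot|move=> x].
have Sx := symmetry_stable (lmul_j_sphere p) x.
have [h13 h02] := lmul_j_coord_zero p x.
by split=> -[[/Sx Mx /h13 Zx]|[/Sx Mx /h02 Zx]]; [left|right|left|right].
Qed.

End symmetries.

(** * Second and fourth moments from the symmetries *)

Section moments.
Context (R : realType) (n : nat).
Notation N := (n * 4)%N.
Implicit Types (x y : 'rV[R]_N) (M : set 'rV[R]_N) (l m p q : 'I_n)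
  (f g : 'rV[R]_N -> R) (a : R).

(** Abstracts integration over a model of volume [V], so that the moment computation is purely
    algebraic and shared by the four models. *)
Record invariant_integral M (V : R) (I : ('rV[R]_N -> R) -> R) : Prop := {
  integral_add : forall f g, continuous f -> continuous g ->
    I (fun x => f x + g x) = I f + I g ;
  integral_scale : forall a f, continuous f -> I (fun x => a * f x) = a * I f ;
  integral_eq : forall f g, (forall x, M x -> f x = g x) -> I f = I g ;
  integral_one : I (fun=> 1) = V ;
  integral_sym : forall F f, symmetry M F -> continuous f ->
    I (fun x => f (F x)) = I f }.

Definition sqnorm x l : R :=
  co x 0 l ^+ 2 + co x 1 l ^+ 2 + co x 2 l ^+ 2 + co x 3 l ^+ 2.

(* The coordinates of the quaternion q_l * conj q_m. *)
Definition qqbar0 x l m : R :=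
  co x 0 l * co x 0 m + co x 1 l * co x 1 m + co x 2 l * co x 2 m + co x 3 l * co x 3 m.
Definition qqbar1 x l m : R :=
  co x 1 l * co x 0 m - co x 0 l * co x 1 m + co x 3 l * co x 2 m - co x 2 l * co x 3 m.
Definition qqbar2 x l m : R :=
  co x 2 l * co x 0 m - co x 0 l * co x 2 m + co x 1 l * co x 3 m - co x 3 l * co x 1 m.
Definition qqbar3 x l m : R :=
  co x 3 l * co x 0 m - co x 0 l * co x 3 m - co x 1 l * co x 2 m + co x 2 l * co x 1 m.

(** With [hopf2] and [hopf3], the components of the edge conj(q_l) i q_l along i, j and k. *)
Definition hopf1 x l : R :=
  co x 0 l ^+ 2 + co x 1 l ^+ 2 - co x 2 l ^+ 2 - co x 3 l ^+ 2.
Definition hopf2 x l : R := 2 * (co x 1 l * co x 2 l - co x 0 l * co x 3 l).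
Definition hopf3 x l : R := 2 * (co x 0 l * co x 2 l + co x 1 l * co x 3 l).
Definition hopf_dot x l m : R :=
  hopf1 x l * hopf1 x m + hopf2 x l * hopf2 x m + hopf3 x l * hopf3 x m.

Lemma hopf_dot_diag x l : hopf_dot x l l = sqnorm x l ^+ 2.
Proof. by rewrite /hopf_dot /hopf1 /hopf2 /hopf3 /sqnorm; ring. Qed.

(** Euler's four-square identity: the quaternion norm is multiplicative on q_l conj(q_m). *)
Lemma four_squares x l m : sqnorm x l * sqnorm x m =
  qqbar0 x l m ^+ 2 + qqbar1 x l m ^+ 2 + (qqbar2 x l m ^+ 2 + qqbar3 x l m ^+ 2).
Proof. by rewrite /sqnorm /qqbar0 /qqbar1 /qqbar2 /qqbar3; ring. Qed.

Let RC := ring_class_continuous R 'rV[R]_N.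

Section class_quadratic.
Context (P : ('rV[R]_N -> R) -> Prop) (PC : ring_class P).
Hypothesis Pco : forall c l, P (fun x => co x c l).

Ltac quadratic := repeat first [exact: Pco | exact: (class_cst PC) |
  apply: (class_sub PC) | apply: (class_opp PC) | apply: (class_add PC) |
  apply: (class_sqr PC) | apply: (class_mul PC)].

Lemma class_sqnorm l : P (fun x => sqnorm x l).
Proof. by rewrite /sqnorm; quadratic. Qed.

Lemma class_qqbar l m : [/\ P (fun x => qqbar0 x l m), P (fun x => qqbar1 x l m),
  P (fun x => qqbar2 x l m) & P (fun x => qqbar3 x l m)].
Proof. by rewrite /qqbar0 /qqbar1 /qqbar2 /qqbar3; split; quadratic. Qed.

Lemma class_hopf l :
  [/\ P (fun x => hopf1 x l), P (fun x => hopf2 x l) & P (fun x => hopf3 x l)].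
Proof.
rewrite /hopf1 /hopf2 /hopf3; split; first by quadratic.
- by apply: (class_mul PC); [exact: (class_cst PC 2)|quadratic].
- by apply: (class_mul PC); [exact: (class_cst PC 2)|quadratic].
Qed.

End class_quadratic.

Lemma continuous_co c l : continuous (fun x => co x c l).
Proof. exact: (class_co (@class_id_continuous R n)). Qed.

Lemma continuous_sqnorm l : continuous (fun x => sqnorm x l).
Proof. exact: (class_sqnorm RC continuous_co). Qed.

Lemma continuous_qqbar l m :
  [/\ continuous (fun x => qqbar0 x l m), continuous (fun x => qqbar1 x l m),
      continuous (fun x => qqbar2 x l m) & continuous (fun x => qqbar3 x l m)].
Proof. exact: (class_qqbar RC continuous_co). Qed.

Lemma continuous_hopf l : [/\ continuous (fun x => hopf1 x l),
  continuous (fun x => hopf2 x l) & continuous (fun x => hopf3 x l)].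
Proof. exact: (class_hopf RC continuous_co). Qed.

Lemma continuous_hopf_dot l m : continuous (fun x => hopf_dot x l m).
Proof.
have [l1 l2 l3] := continuous_hopf l; have [m1 m2 m3] := continuous_hopf m.
apply: (class_add RC); first apply: (class_add RC).
- exact: (class_mul RC l1 m1).
- exact: (class_mul RC l2 m2).
- exact: (class_mul RC l3 m3).
Qed.

Section invariant_integral_theory.
Context M (V : R) (I : ('rV[R]_N -> R) -> R) (HI : invariant_integral M V I).

Lemma integral_sum (J : Type) (s : seq J) (P : pred J) (f : J -> 'rV[R]_N -> R) :
  (forall j, continuous (f j)) ->
  I (fun x => \sum_(j <- s | P j) f j x) = \sum_(j <- s | P j) I (f j).
Proof.
move=> cf; have I0 : I (fun=> 0) = 0.
  rewrite -[RHS](mul0r (I (fun=> 0))) -(integral_scale HI); last exact: cst_continuous.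
  by congr I; apply/funext => x; rewrite mul0r.
elim: s => [|j s IH].
  by rewrite big_nil -[RHS]I0; congr I; apply/funext => x; rewrite big_nil.
rewrite big_cons; case: ifP => Pj.
  rewrite -IH -(integral_add HI).
  - by congr I; apply/funext => x; rewrite big_cons Pj.
  - exact: cf.
  - by apply: (class_sum RC).
by rewrite -IH; congr I; apply/funext => x; rewrite big_cons Pj.
Qed.

Hypothesis MS : M `<=` @sphere_set R n.
Hypothesis rotM : forall p q c s, p != q -> c ^+ 2 + s ^+ 2 = 1 ->
  symmetry M (row_rot p q c s).

Definition moment2 l := I (fun x => sqnorm x l).
Definition moment4 l := I (fun x => sqnorm x l ^+ 2).
Definition moment22 l m := I (fun x => sqnorm x l * sqnorm x m).
Definition momentC l m := I (fun x => qqbar0 x l m ^+ 2).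

(** The quarter turn exchanges two edges up to the sign of one quaternion, which norms and Hopf
    images do not see. *)
Lemma rot_swap p q : p != q -> symmetry M (row_rot p q 0 1).
Proof. by move=> pq; apply: rotM => //; ring. Qed.

Lemma sqnorm_swap p q x : sqnorm (row_rot p q 0 1 x) p = sqnorm x q.
Proof. by rewrite /sqnorm !co_rot eqxx; ring. Qed.

Lemma moment2_const l m : moment2 l = moment2 m.
Proof.
have [->//|lm] := eqVneq l m.
rewrite /moment2 -(integral_sym HI (rot_swap lm) (@continuous_sqnorm l)).
by congr I; apply/funext => x; rewrite sqnorm_swap.
Qed.

Lemma moment4_const l m : moment4 l = moment4 m.
Proof.
have [->//|lm] := eqVneq l m.
have c4 : continuous (fun x => sqnorm x l ^+ 2).
  by apply: (class_sqr RC); exact: continuous_sqnorm.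
rewrite /moment4 -(integral_sym HI (rot_swap lm) c4).
by congr I; apply/funext => x; rewrite sqnorm_swap.
Qed.

Lemma sum_sqnorm x : sphere_set x -> \sum_l sqnorm x l = 2.
Proof.
move=> <-; rewrite -/(dot x x) dot_sum; apply: eq_bigr => l _.
by rewrite /sqnorm; ring.
Qed.

Lemma moment2E l : n%:R * moment2 l = 2 * V.
Proof.
rewrite -(integral_one HI) -(integral_scale HI); last exact: cst_continuous.
transitivity (\sum_m moment2 m).
  rewrite (eq_bigr (fun=> moment2 l)) => [|m _]; last exact: moment2_const.
  by rewrite sumr_const card_ord mulr_natl.
rewrite /moment2 -integral_sum; last exact: continuous_sqnorm.
by apply: (integral_eq HI) => x /MS Sx; rewrite sum_sqnorm// mulr1.
Qed.

Lemma sum_moment22 l : moment4 l + \sum_(m | m != l) moment22 l m = 2 * moment2 l.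
Proof.
have -> : moment4 l = moment22 l l.
  by congr I; apply/funext => x; rewrite expr2.
rewrite -(bigD1 l (P := predT) (F := moment22 l))//= /moment22 -integral_sum; last first.
  by move=> m; apply: (class_mul RC); exact: continuous_sqnorm.
rewrite /moment2 -(integral_scale HI); last exact: continuous_sqnorm.
apply: (integral_eq HI) => x /MS Sx.
by rewrite -mulr_sumr sum_sqnorm// mulrC.
Qed.

(* Compares the fourth moments before and after the rotation by pi/4 mixing
   the l-th and m-th quaternions. *)
Lemma moment4_rot l m : l != m -> moment4 l = moment22 l m + 2 * momentC l m.
Proof.
move=> lm; pose r : R := (Num.sqrt 2)^-1.
have r2 : r ^+ 2 = 2^-1 by rewrite exprVn sqr_sqrtr.
have rr : r ^+ 2 + r ^+ 2 = 1 by rewrite r2; field.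
have c4 p : continuous (fun x => sqnorm x p ^+ 2).
  by apply: (class_sqr RC); exact: continuous_sqnorm.
have [c0 _ _ _] := continuous_qqbar l m.
have sl x : sqnorm (row_rot l m r r x) l =
    r ^+ 2 * (sqnorm x l + sqnorm x m + 2 * qqbar0 x l m).
  by rewrite /sqnorm /qqbar0 !co_rot eqxx; ring.
have sm x : sqnorm (row_rot l m r r x) m =
    r ^+ 2 * (sqnorm x l + sqnorm x m - 2 * qqbar0 x l m).
  by rewrite /sqnorm /qqbar0 !co_rot eqxx eq_sym (negbTE lm); ring.
(* With A, B the two squared norms and C = [qqbar0 x l m], the rotated squared norms are (A + B)/2 +
   C and (A + B)/2 - C; their squares add up to (A^2 + B^2)/2 + AB + 2C^2. *)
have E : moment4 l + moment4 m = 2^-1 * (moment4 l + moment4 m) +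
    (moment22 l m + 2 * momentC l m).
  rewrite {1 2}/moment4 -(integral_sym HI (rotM lm rr) (c4 l)).
  rewrite -(integral_sym HI (rotM lm rr) (c4 m)) -(integral_add HI); last 2 first.
  - have -> : (fun x => sqnorm (row_rot l m r r x) l ^+ 2) = (fun x => 
      (2^-1 * (sqnorm x l + sqnorm x m + 2 * qqbar0 x l m)) ^+ 2).
      by apply/funext => x; rewrite sl r2.
    apply: (class_sqr RC); apply: (class_mul RC); first exact: (class_cst RC).
    apply: (class_add RC); first by apply: (class_add RC); exact: continuous_sqnorm.
    by apply: (class_mul RC) => //; exact: (class_cst RC).
  - have -> : (fun x => sqnorm (row_rot l m r r x) m ^+ 2) = (fun x => 
      (2^-1 * (sqnorm x l + sqnorm x m - 2 * qqbar0 x l m)) ^+ 2).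
      by apply/funext => x; rewrite sm r2.
    apply: (class_sqr RC); apply: (class_mul RC); first exact: (class_cst RC).
    apply: (class_sub RC); first by apply: (class_add RC); exact: continuous_sqnorm.
    by apply: (class_mul RC) => //; exact: (class_cst RC).
  have c2 p q : continuous (fun x => sqnorm x p * sqnorm x q).
    by apply: (class_mul RC); exact: continuous_sqnorm.
  have c0s : continuous (fun x => qqbar0 x l m ^+ 2) by apply: (class_sqr RC).
  have cz a f : continuous f -> continuous (fun x : 'rV[R]_N => a * f x : R).
    by move=> cf; apply: (class_mul RC) => //; exact: (class_cst RC).
  have cS : continuous (fun x => sqnorm x l ^+ 2 + sqnorm x m ^+ 2).
    exact: (class_add RC (c4 l) (c4 m)).
  have cT : continuous (fun x => sqnorm x l * sqnorm x m + 2 * qqbar0 x l m ^+ 2).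
    exact: (class_add RC (c2 l m) (cz 2 _ c0s)).
  rewrite /moment4 /moment22 /momentC -(integral_scale HI 2 c0s).
  rewrite -(integral_add HI (c2 l m) (cz 2 _ c0s)) -(integral_add HI (c4 l) (c4 m)).
  rewrite -(integral_scale HI 2^-1 cS) -(integral_add HI (cz _ _ cS) cT).
  by congr I; apply/funext => x; rewrite sl sm r2; field.
have := moment4_const l m; move: E; move: (moment4 l) (moment4 m) => a b E ab.
by move: E; rewrite -ab => E; lra.
Qed.

Lemma sum_moment4 l : \sum_(m | m != l) moment4 l = (n%:R - 1) * moment4 l.
Proof.
rewrite sumr_const cardC1 card_ord -[in RHS](@prednK n) ?(leq_ltn_trans _ (ltn_ord l))//.
by rewrite -natr1 addrK mulr_natl.
Qed.

Lemma integral_sq_add f g : continuous f -> continuous g ->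
  I (fun x => f x ^+ 2 + g x ^+ 2) = I (fun x => f x ^+ 2) + I (fun x => g x ^+ 2).
Proof.
by move=> cf cg; apply: (integral_add HI); apply: (class_sqr RC).
Qed.

(** Left multiplication of q_l by i multiplies q_l conj(q_m) by i, which permutes its coordinates up
    to sign: 0 with 1, 2 with 3. *)
Lemma lmul_i_qqbar l m x : l != m ->
  [/\ qqbar0 (lmul_i l x) l m ^+ 2 = qqbar1 x l m ^+ 2 &
      qqbar2 (lmul_i l x) l m ^+ 2 = qqbar3 x l m ^+ 2].
Proof.
move=> lm; rewrite /qqbar0 /qqbar1 /qqbar2 /qqbar3 !co_lmul_i// eqxx (eq_sym m).
by rewrite (negbTE lm) /=; split; ring.
Qed.

Lemma lmul_j_qqbar l m x : l != m ->
  [/\ qqbar0 (lmul_j l x) l m ^+ 2 = qqbar2 x l m ^+ 2 &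
      qqbar1 (lmul_j l x) l m ^+ 2 = qqbar3 x l m ^+ 2].
Proof.
move=> lm; rewrite /qqbar0 /qqbar1 /qqbar2 /qqbar3 !co_lmul_j// eqxx (eq_sym m).
by rewrite (negbTE lm) /=; split; ring.
Qed.

Lemma momentC_lmul_i l m : l != m -> symmetry M (lmul_i l) ->
  I (fun x => qqbar1 x l m ^+ 2) = momentC l m /\
  I (fun x => qqbar3 x l m ^+ 2) = I (fun x => qqbar2 x l m ^+ 2).
Proof.
move=> lm sM; have [c0 c1 c2 c3] := continuous_qqbar l m.
rewrite /momentC -(integral_sym HI sM (class_sqr RC c0)).
rewrite -(integral_sym HI sM (class_sqr RC c2)).
by split; congr I; apply/funext => x; have [E E'] := lmul_i_qqbar x lm; rewrite ?E ?E'.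
Qed.

Lemma momentC_lmul_j l m : l != m -> symmetry M (lmul_j l) ->
  I (fun x => qqbar2 x l m ^+ 2) = momentC l m /\
  I (fun x => qqbar3 x l m ^+ 2) = I (fun x => qqbar1 x l m ^+ 2).
Proof.
move=> lm sM; have [c0 c1 c2 c3] := continuous_qqbar l m.
rewrite /momentC -(integral_sym HI sM (class_sqr RC c0)).
rewrite -(integral_sym HI sM (class_sqr RC c1)).
by split; congr I; apply/funext => x; have [E E'] := lmul_j_qqbar x lm; rewrite ?E ?E'.
Qed.

(** q_l conj(q_m) lies in R + jR as soon as both quaternions lie in R + jR or both in iR + kR. *)
Lemma real_qqbar x l m : real_model setT x -> qqbar1 x l m = 0 /\ qqbar3 x l m = 0.
Proof.
rewrite /qqbar1 /qqbar3 => -[[_ h]|[_ h]]; have [h1 h2] := h l; have [h3 h4] := h m;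
  by rewrite h1 h2 h3 h4; split; ring.
Qed.

(** Replacing q_l by j q_l reverses the edge e_l, because conj(j) i j = -i, and keeps e_m. *)
Lemma hopf_dot_lmul_j l m : l != m -> symmetry M (lmul_j l) ->
  I (fun x => hopf_dot x l m) = 0.
Proof.
move=> lm sM; have E : I (fun x => hopf_dot x l m) = - 1 * I (fun x => hopf_dot x l m).
  rewrite -(integral_scale HI); last exact: continuous_hopf_dot.
  rewrite -[LHS](integral_sym HI sM); last exact: continuous_hopf_dot.
  congr I; apply/funext => x; rewrite /hopf_dot /hopf1 /hopf2 /hopf3.
  by rewrite !co_lmul_j// eqxx (eq_sym m) (negbTE lm) /=; ring.
by lra.
Qed.

(** Invariance under i and j equalizes the second moments of the four coordinates of q_l conj(q_m),
    so [moment22 l m] is 4 times [momentC l m]. By [moment4_rot] it is then 2/3 of [moment4 l], and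
    1 + 2(n - 1)/3 = (2n + 1)/3. *)
Lemma sphere_moment4 l : (forall l, symmetry M (lmul_i l)) ->
  (forall l, symmetry M (lmul_j l)) ->
  (2 * n%:R + 1) * moment4 l = 6 * moment2 l.
Proof.
move=> si sj; have Y m : m != l -> moment22 l m = 2 / 3 * moment4 l.
  move=> ml; have lm : l != m by rewrite eq_sym.
  have [c0 c1 c2 c3] := continuous_qqbar l m.
  have [i1 i3] := momentC_lmul_i lm (si l); have [j2 _] := momentC_lmul_j lm (sj l).
  have Y4 : moment22 l m = 4 * momentC l m.
    transitivity (I (fun x => qqbar0 x l m ^+ 2 + qqbar1 x l m ^+ 2 +
        (qqbar2 x l m ^+ 2 + qqbar3 x l m ^+ 2))).
      by congr I; apply/funext => x; rewrite four_squares.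
    rewrite (integral_add HI); first last.
    - by apply: (class_add RC); apply: (class_sqr RC).
    - by apply: (class_add RC); apply: (class_sqr RC).
    rewrite !integral_sq_add// i3 i1 j2 -/(momentC l m); ring.
  by have := moment4_rot lm; rewrite Y4 => ->; field.
have := sum_moment22 l; rewrite (eq_bigr _ Y) -mulr_sumr sum_moment4 => h.
by transitivity (3 * (2 * moment2 l)); [rewrite -h; field|ring].
Qed.

(** Only two coordinates of q_l conj(q_m) survive, and j equalizes them: the ratio 2/3 of the
    spatial case becomes 1/2. *)
Lemma real_sphere_moment4 l : (forall x, M x -> real_model setT x) ->
  (forall l, symmetry M (lmul_j l)) ->
  (n%:R + 1) * moment4 l = 4 * moment2 l.
Proof.
move=> MR sj; have Y m : m != l -> moment22 l m = 1 / 2 * moment4 l.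
  move=> ml; have lm : l != m by rewrite eq_sym.
  have [c0 c1 c2 c3] := continuous_qqbar l m.
  have [j2 _] := momentC_lmul_j lm (sj l).
  have Y2 : moment22 l m = 2 * momentC l m.
    transitivity (I (fun x => qqbar0 x l m ^+ 2 + qqbar2 x l m ^+ 2)).
      apply: (integral_eq HI) => x Mx; rewrite four_squares.
      by have [-> ->] := real_qqbar l m (MR x Mx); ring.
    by rewrite integral_sq_add// j2 -/(momentC l m); ring.
  by have := moment4_rot lm; rewrite Y2 => ->; field.
have := sum_moment22 l; rewrite (eq_bigr _ Y) -mulr_sumr sum_moment4 => h.
by transitivity (2 * (2 * moment2 l)); [rewrite -h; field|ring].
Qed.

Section stiefel.
Hypothesis MP : M `<=` @stiefel_set R n.

(* The projection matrix a a^* + b b^* is idempotent: its (l, m) entry is the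
   complex part of q_l * conj q_m. *)
Lemma stiefel_projection x l : stiefel_set x ->
  \sum_m (qqbar0 x l m ^+ 2 + qqbar1 x l m ^+ 2) = sqnorm x l.
Proof.
move=> [a b r i].
transitivity ((co x 0 l ^+ 2 + co x 1 l ^+ 2) * aaRe x x +
  (co x 2 l ^+ 2 + co x 3 l ^+ 2) * bbRe x x +
  2 * (co x 0 l * co x 2 l + co x 1 l * co x 3 l) * baRe x x +
  2 * (co x 0 l * co x 3 l - co x 1 l * co x 2 l) * baIm x x).
  rewrite /aaRe /bbRe /baRe /baIm /csum -sumrB -!big_split /= !mulr_sumr -!big_split /=.
  by apply: eq_bigr => m _; rewrite /qqbar0 /qqbar1; ring.
by rewrite a b r i /sqnorm; ring.
Qed.

(** The mean of a diagonal entry of P^2 = P, where P is the projection; the term m = l is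
    [moment4 l] because P_ll = |q_l|^2. *)
Lemma sum_momentC l : moment4 l +
  \sum_(m | m != l) (momentC l m + I (fun x => qqbar1 x l m ^+ 2)) = moment2 l.
Proof.
have -> : moment4 l = I (fun x => qqbar0 x l l ^+ 2 + qqbar1 x l l ^+ 2).
  by congr I; apply/funext => x; rewrite /sqnorm /qqbar0 /qqbar1; ring.
have E m : momentC l m + I (fun x => qqbar1 x l m ^+ 2) =
    I (fun x => qqbar0 x l m ^+ 2 + qqbar1 x l m ^+ 2).
  by have [c0 c1 _ _] := continuous_qqbar l m; rewrite integral_sq_add.
rewrite (eq_bigr _ (fun m _ => E m)).
rewrite -(bigD1 l (P := predT)
  (F := fun m => I (fun x => qqbar0 x l m ^+ 2 + qqbar1 x l m ^+ 2)))//=.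
rewrite -integral_sum => [|m]; last first.
  by have [c0 c1 _ _] := continuous_qqbar l m; apply: (class_add RC); apply: (class_sqr RC).
by apply: (integral_eq HI) => x /MP Sx; exact: stiefel_projection.
Qed.

(** Invariance under i and [moment4_rot] turn the summand of [sum_momentC] into
    [moment4 l - moment22 l m]; adding [sum_moment22] cancels the mixed moments. *)
Lemma stiefel_moment4 l : (forall l, symmetry M (lmul_i l)) ->
  (n%:R + 1) * moment4 l = 3 * moment2 l.
Proof.
move=> si; have E m : m != l -> momentC l m + I (fun x => qqbar1 x l m ^+ 2) =
    moment4 l - moment22 l m.
  move=> ml; have lm : l != m by rewrite eq_sym.
  have [-> _] := momentC_lmul_i lm (si l); rewrite (moment4_rot lm); ring.
have := sum_momentC l; rewrite (eq_bigr _ E) sumrB sum_moment4 => h.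
have h' := sum_moment22 l.
by lra.
Qed.

(** [qqbar1] vanishes on the real models, which halves the summand of the complex case. *)
Lemma real_stiefel_moment4 l : (forall x, M x -> real_model setT x) ->
  (n%:R + 2) * moment4 l = 4 * moment2 l.
Proof.
move=> MR; have E m : m != l -> momentC l m + I (fun x => qqbar1 x l m ^+ 2) =
    2^-1 * (moment4 l - moment22 l m).
  move=> ml; have lm : l != m by rewrite eq_sym.
  have -> : I (fun x => qqbar1 x l m ^+ 2) = 0.
    transitivity (I (fun=> 0 * 1)).
      apply: (integral_eq HI) => x Mx.
      by have [-> _] := real_qqbar l m (MR x Mx); rewrite mul0r expr0n.
    by rewrite (integral_scale HI) ?mul0r//; exact: cst_continuous.
  by rewrite (moment4_rot lm); field.
have := sum_momentC l; rewrite (eq_bigr _ E) -mulr_sumr sumrB sum_moment4 => h.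
have h' := sum_moment22 l.
by lra.
Qed.

(** The edges sum to the vector with components |a|^2 - |b|^2, -2 Im <b, a> and 2 Re <b, a>:
    orthonormality of the pair makes the polygon closed. *)
Lemma stiefel_closed x : stiefel_set x ->
  [/\ \sum_m hopf1 x m = 0, \sum_m hopf2 x m = 0 & \sum_m hopf3 x m = 0].
Proof.
move=> [a b r i]; split.
- transitivity (aaRe x x - bbRe x x); last by rewrite a b subrr.
  rewrite /aaRe /bbRe /csum -!big_split -sumrB; apply: eq_bigr => m _ /=.
  by rewrite /hopf1; ring.
- transitivity (- 2 * baIm x x); last by rewrite i mulr0.
  rewrite /baIm /csum -sumrB mulr_sumr; apply: eq_bigr => m _ /=.
  by rewrite /hopf2; ring.
- transitivity (2 * baRe x x); last by rewrite r mulr0.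
  rewrite /baRe /csum -big_split mulr_sumr; apply: eq_bigr => m _ /=.
  by rewrite /hopf3; ring.
Qed.

Lemma hopf_dot_swap l p q : l != p -> l != q -> 
  I (fun x => hopf_dot x l p) = I (fun x => hopf_dot x l q).
Proof.
have [->//|pq lp lq] := eqVneq p q.
rewrite -(integral_sym HI (rot_swap pq)); last exact: continuous_hopf_dot.
congr I; apply/funext => x; rewrite /hopf_dot /hopf1 /hopf2 /hopf3.
by rewrite !co_rot (negbTE lp) (negbTE lq) eqxx; ring.
Qed.

(** Pairs e_l with the vanishing sum of all edges; the n - 1 off-diagonal products have equal means
    by [hopf_dot_swap]. *)
Lemma stiefel_hopf_dot l m : l != m ->
  moment4 l + (n%:R - 1) * I (fun x => hopf_dot x l m) = 0.
Proof.
move=> lm.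
have -> : moment4 l = I (fun x => hopf_dot x l l).
  by congr I; apply/funext => x; rewrite hopf_dot_diag.
have -> : (n%:R - 1) * I (fun x => hopf_dot x l m) =
    \sum_(p | p != l) I (fun x => hopf_dot x l p).
  rewrite (eq_bigr (fun=> I (fun x => hopf_dot x l m))) => [|p pl]; last first.
    by apply: hopf_dot_swap => //; rewrite eq_sym.
  rewrite sumr_const cardC1 card_ord -{1}(@prednK n) ?(leq_ltn_trans _ (ltn_ord l))//.
  by rewrite -natr1 addrK mulr_natl.
rewrite -(bigD1 l (P := predT) (F := fun p => I (fun x => hopf_dot x l p)))//=.
rewrite -integral_sum; last exact: continuous_hopf_dot.
transitivity (I (fun=> 0 * 1)).
  apply: (integral_eq HI) => x /MP/stiefel_closed[h1 h2 h3].
  transitivity (hopf1 x l * (\sum_m hopf1 x m) + hopf2 x l * (\sum_m hopf2 x m) +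
      hopf3 x l * (\sum_m hopf3 x m)).
    by rewrite !mulr_sumr -!big_split.
  by rewrite h1 h2 h3; ring.
by rewrite (integral_scale HI) ?mul0r//; exact: cst_continuous.
Qed.

End stiefel.

Definition chord_form (k : nat) x :=
  \sum_(l < n | (l < k)%N) \sum_(m < n | (m < k)%N) hopf_dot x l m.

Lemma integral_chord k l (C : R) : (k <= n)%N ->
  (forall p q, p != q -> I (fun x => hopf_dot x p q) = C) ->
  I (chord_form k) = k%:R * (moment4 l + (k%:R - 1) * C).
Proof.
move=> kn hC; rewrite /chord_form integral_sum => [|p]; last first.
  by apply: (class_sum RC) => q; exact: continuous_hopf_dot.
have cardk : #|[pred p : 'I_n | (p < k)%N]| = k.
  rewrite -sum1_card -(big_ord_widen n (fun=> 1%N) kn) sum1_card card_ord.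
  by [].
rewrite (eq_bigr (fun=> moment4 l + (k%:R - 1) * C)) => [|p pk].
  by rewrite sumr_const cardk mulr_natl.
rewrite integral_sum => [|q]; last exact: continuous_hopf_dot.
rewrite (bigD1 p)//=; congr (_ + _).
  rewrite -(moment4_const p l).
  by congr I; apply/funext => x; rewrite hopf_dot_diag.
rewrite (eq_bigr (fun=> C)) => [|q /andP[_ qp]]; last by rewrite hC// eq_sym.
rewrite sumr_const.
have -> : #|[pred q : 'I_n | (q < k)%N && (q != p)]| = k.-1.
  have := cardk; rewrite (cardD1 p) inE pk add1n => /(congr1 predn)/= <-.
  by apply: eq_card => q; rewrite !inE andbC.
(* [pk] gives [0 < k], so that [k.-1] casts to [k%:R - 1]. *)
by case: (k) pk => // k' _; rewrite -natr1 addrK mulr_natl.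
Qed.

End invariant_integral_theory.
End moments.

(** * Integration of continuous functions over a model *)

Lemma continuous_measurable (R : realType) (T : ptopologicalType) (f : T -> R) :
  continuous f -> measurable_fun setT (f : borel T -> R).
Proof.
move=> cf; apply: (@measurability _ _ (borel T) _ setT f
  (@RGenOpens.G R)).
  exact: RGenOpens.measurableE.
move=> _ [_ [x [y ->]] <-]; rewrite setTI; apply: open_borel.
by apply: (@open_comp _ _ f `]x, y[%classic); [move=> t _; exact: cf|exact: interval_open].
Qed.

Section model_integral.
Context (R : realType) (n m : nat) (M : set 'rV[R]_(n * 4)).
Notation N := (n * 4)%N.
Context (vol : {measure set (borel 'rV[R]_N) -> \bar R}).
Hypotheses (cM : compact M) (chM : has_charts m M).
Hypotheses (rv : riemannian_volume m M vol) (finM : (vol M < +oo)%E).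

Definition model_integral (f : 'rV[R]_N -> R) : R := Rintegral vol M f.

Lemma measurable_model : measurable (M : set (borel 'rV[R]_N)).
Proof. by apply: closed_borel; apply: compact_closed => //; exact: norm_hausdorff. Qed.

Lemma continuous_integrable (f : 'rV[R]_N -> R) :
  continuous f -> vol.-integrable M (EFin \o f).
Proof.
move=> cf; apply: measurable_bounded_integrable.
- exact: measurable_model.
- exact: finM.
- exact: measurable_funTS (continuous_measurable cf).
- have : compact (f @` M).
    by apply: continuous_compact => //; apply: continuous_subspaceT => x; exact: cf.
  move=> /compact_bounded[r [rr h]]; exists r; split => // s rs x Mx.
  by apply: h => //; exists x.
Qed.

(** The substantial rule is invariance: the image of [vol] under the matrix of the symmetry is [vol]
    itself, and [M] is its own preimage, so the change of variables preserves the integral. *)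
Lemma model_invariant_integral :
  invariant_integral M (fine (vol M)) model_integral.
Proof.
have mM := measurable_model.
split.
- move=> f g cf cg; apply: RintegralD => //; exact: continuous_integrable.
- move=> a f cf; apply: RintegralZl => //; exact: continuous_integrable.
- by move=> f g fg; apply: eq_Rintegral => x /set_mem; exact: fg.
- by rewrite /model_integral Rintegral_cst// mul1r.
- move=> F f sF cf; have [T TT FE] := symmetry_mx sF.
  have MT x : M (x *m T) <-> M x by rewrite -FE; exact: symmetry_stable sF x.
  have cT : continuous (fun x : 'rV[R]_N => x *m T) by exact: mulmxr_continuous.
  have mT := continuous_borel cT.
  have FMM : (fun x : 'rV[R]_N => x *m T) @^-1` M = M.
    by apply/seteqP; split => x /MT.
  have mf := continuous_measurable cf.
  have cfT : continuous (fun x : 'rV[R]_N => f (x *m T)).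
    by move=> x; apply: continuous_comp; [exact: cT|exact: cf].
  have mEf : @measurable_fun _ _ (borel 'rV[R]_N) (\bar R) setT (EFin \o f).
    exact/measurable_EFinP.
  have iEf := continuous_integrable cfT; rewrite -[X in _.-integrable X]FMM in iEf.
  have E := integral_pushforward mT mEf iEf mM.
  rewrite /model_integral /Rintegral; congr fine.
  transitivity (\int[vol]_(x in M) (f (x *m T))%:E)%E.
    by apply: eq_integral => x _; rewrite FE.
  rewrite FMM in E; rewrite -[LHS]E; apply: eq_measure_integral => A mA _.
  exact: (riemannian_volume_mulmxr cM chM rv TT MT mA).
Qed.

End model_integral.

(** * From quaternions to edge lists, and expectations as integrals over the model *)

Section edges.
Context (R : realType) (d n : nat).
Hypothesis hd : d = 2%N \/ d = 3%N.
Notation N := (n * 4)%N.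
Implicit Types (x : 'rV[R]_N) (e : 'M[R]_(n, d)).

Lemma quat_slot_lt (i : 'I_d) : (quat_slot d i < 4)%N.
Proof.
move: i; case: hd => -> [i /=]; rewrite /quat_slot /=.
  by case: i => [|[|//]].
by case: i => [|[|[|//]]].
Qed.

Lemma quat_slot_inj : injective (fun i : 'I_d => quat_slot d i).
Proof.
move=> [i hi] [j hj] /= ij; apply/val_inj => /=; move: hi hj ij.
case: hd => ->; rewrite /quat_slot /=.
  by case: i => [|[|//]] _; case: j => [|[|//]].
by case: i => [|[|[|//]]] _; case: j => [|[|[|//]]].
Qed.

Definition edges_of_quat (A : 'M[R]_(n, 4)) : 'M[R]_(n, d) :=
  \matrix_(l < n, i < d) A l (inord (quat_slot d i)).

Lemma quat_of_edgesK : cancel (@quat_of_edges R d n) edges_of_quat.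
Proof.
move=> e; apply/matrixP => l i; rewrite !mxE (big_pred1 i)// => j /=.
rewrite inordK ?quat_slot_lt//; apply/eqP/eqP => [/quat_slot_inj//|-> //].
Qed.

Definition edges x : 'M[R]_(n, d) := edges_of_quat (hopfn x).

Lemma qc_hopf (q : 'rV[R]_4) (c : nat) : (c < 4)%N -> qc (hopf q) c =
  [:: 0; qc q 0 ^+ 2 + qc q 1 ^+ 2 - qc q 2 ^+ 2 - qc q 3 ^+ 2;
      2 * (qc q 1 * qc q 2 - qc q 0 * qc q 3);
      2 * (qc q 0 * qc q 2 + qc q 1 * qc q 3)]`_c.
Proof.
move=> c4; rewrite /hopf /qmul /qconj /qi !qc_mkquat//=.
by case: c c4 => [|[|[|[|]]]] //= _; ring.
Qed.

Lemma hopfn_co x l (c : 'I_4) :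
  hopfn x l c = [:: 0; hopf1 x l; hopf2 x l; hopf3 x l]`_c.
Proof.
rewrite mxE -[RHS](_ : qc (hopf (qcoord x l)) c = _); last by rewrite qc_hopf.
by rewrite /qc inord_val.
Qed.

Lemma edges_co x l i :
  edges x l i = [:: 0; hopf1 x l; hopf2 x l; hopf3 x l]`_(quat_slot d i).
Proof. by rewrite mxE hopfn_co inordK// quat_slot_lt. Qed.

(** In dimension 2 the Hopf image must lie in the plane iR + kR, so that [edges] discards only
    zeros; in dimension 3 the condition is empty. *)
Definition in_slots x := d = 2%N -> forall l, hopf2 x l = 0.

Lemma sum_slots (f : nat -> R) : \sum_(i < d) f (quat_slot d i) =
  if d == 2 then f 1 + f 3 else f 1 + f 2 + f 3.
Proof.
by case: hd => ->; rewrite !big_ord_recl big_ord0 /= addr0 ?addrA.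
Qed.

Lemma edgesK x : in_slots x -> quat_of_edges (edges x) = hopfn x.
Proof.
move=> h; apply/matrixP => l c; rewrite hopfn_co mxE big_mkcond /=.
pose f k := if k == c :> nat then [:: 0; hopf1 x l; hopf2 x l; hopf3 x l]`_k else 0.
rewrite (eq_bigr (fun i : 'I_d => f (quat_slot d i))) => [|i _].
  rewrite sum_slots /f; case: (eqVneq d 2%N) => [/h h2|_].
    by case: c {f} => -[|[|[|[|//]]]] c4 /=; rewrite ?h2; ring.
  by case: c {f} => -[|[|[|[|//]]]] c4 /=; ring.
by rewrite /f edges_co.
Qed.

Lemma dot_edges x l m : in_slots x ->
  \sum_(i < d) edges x l i * edges x m i = hopf_dot x l m.
Proof.
move=> h; pose f k := [:: 0; hopf1 x l; hopf2 x l; hopf3 x l]`_k *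
  [:: 0; hopf1 x m; hopf2 x m; hopf3 x m]`_k.
rewrite (eq_bigr (fun i : 'I_d => f (quat_slot d i))) => [|i _]; last first.
  by rewrite !edges_co.
rewrite sum_slots /f /hopf_dot; case: (eqVneq d 2%N) => [/h h2|_] //=.
by rewrite h2; ring.
Qed.

Lemma enorm_rowE k (v : 'rV[R]_k) : enorm v ^+ 2 = \sum_(i < k) v 0 i * v 0 i.
Proof.
rewrite /enorm sqr_sqrtr; last by apply: sumr_ge0 => i _; rewrite sqr_ge0.
by apply: eq_bigr => i _; rewrite expr2.
Qed.

Lemma sqnorm_ge0 x l : 0 <= sqnorm x l.
Proof. by rewrite /sqnorm !addr_ge0 ?sqr_ge0. Qed.

Lemma enorm_edges x l : in_slots x -> enorm (row l (edges x)) = sqnorm x l.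
Proof.
move=> h; rewrite -[RHS]ger0_norm ?sqnorm_ge0// -[RHS]sqrtr_sqr -hopf_dot_diag.
rewrite -(dot_edges _ _ h) /enorm; congr Num.sqrt.
by apply: eq_bigr => i _; rewrite mxE expr2.
Qed.

Lemma Chord_edges k x : in_slots x -> Chord k (edges x) = chord_form k x.
Proof.
move=> h; rewrite /Chord enorm_rowE.
under eq_bigr do rewrite summxE mulr_suml.
rewrite exchange_big /=; apply: eq_bigr => l lk.
under eq_bigr do rewrite mulr_sumr.
rewrite exchange_big /=; apply: eq_bigr => m mk.
by rewrite -(dot_edges _ _ h); apply: eq_bigr => i _; rewrite !mxE.
Qed.

Lemma edges_Arm x : in_slots x -> sphere_set x -> @Arm R d n (edges x).
Proof.
move=> h Sx; rewrite /Arm /= -(sum_sqnorm Sx); apply: eq_bigr => l _.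
exact: enorm_edges.
Qed.

Lemma edges_Pol x : in_slots x -> stiefel_set x -> @Pol R d n (edges x).
Proof.
move=> h Sx; split; first by apply: edges_Arm => //; exact: stiefel_sphere.
apply/rowP => i; rewrite summxE [RHS]mxE.
have [h1 h2 h3] := stiefel_closed Sx.
rewrite (eq_bigr (fun l => [:: 0; hopf1 x l; hopf2 x l; hopf3 x l]`_(quat_slot d i))).
  move: (quat_slot d i) (quat_slot_lt i) => [|[|[|[|//]]]] _ //=.
  by rewrite big1.
by move=> l _; rewrite mxE edges_co.
Qed.

Lemma continuous_enorm_mx (T : topologicalType) k (f : T -> 'rV[R]_k) :
  continuous f -> continuous (fun t => enorm (f t)).
Proof.
move=> cf; have cS : continuous (fun t => \sum_(i < k) f t 0 i ^+ 2).
  apply: continuous_sumr => i _; apply: continuousX_fun => s.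
  exact: (continuous_comp (cf s) (@coord_continuous _ _ _ 0 i (f s))).
move=> t; exact: (continuous_comp (cS t) (@sqrt_continuous R _)).
Qed.

Lemma continuous_row l : continuous (fun e => row l e).
Proof.
apply: continuous_mx => i j; rewrite (_ : (fun e => _) = fun e => e l j).
  exact: coord_continuous.
by apply/funext => e; rewrite mxE.
Qed.

Lemma closed_Arm : closed (@Arm R d n).
Proof.
apply: closed_eq_continuous; apply: continuous_sumr => l _.
by apply: continuous_enorm_mx; exact: continuous_row.
Qed.

Lemma continuous_row_sum (P : pred 'I_n) :
  continuous (fun e => \sum_(l < n | P l) row l e).
Proof.
apply: continuous_mx => i j.
rewrite (_ : (fun e => _) = fun e => \sum_(l < n | P l) e l j).
  by apply: continuous_sumr => l _; exact: coord_continuous.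
by apply/funext => e; rewrite summxE; apply: eq_bigr => l _; rewrite mxE.
Qed.

Lemma closed_Pol : closed (@Pol R d n).
Proof.
apply: closedI; first exact: closed_Arm.
apply: (@preimage_closed _ _ (fun e => \sum_(l < n) row l e) [set 0]).
  by move=> e _; exact: continuous_row_sum.
by apply: compact_closed; [exact: norm_hausdorff|exact: compact_set1].
Qed.

Lemma continuous_Chord k : continuous (@Chord R d n k).
Proof.
by apply: continuousX_fun; apply: continuous_enorm_mx; exact: continuous_row_sum.
Qed.

Lemma continuous_edges : continuous edges.
Proof.
apply: continuous_mx => l i.
rewrite (_ : (fun x => _) = fun x => [:: 0; hopf1 x l; hopf2 x l; hopf3 x l]`_(quat_slot d i)).
  have [c1 c2 c3] := continuous_hopf R l.
  move: (quat_slot d i) (quat_slot_lt i) => [|[|[|[|//]]]] _ //=.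
  exact: cst_continuous.
by apply/funext => x; rewrite edges_co.
Qed.

Section expectation.
Context (m : nat) (M : set 'rV[R]_N) (sigma : probability (borel 'M[R]_(n, d)) R).
Hypotheses (cM : compact M) (chM : has_charts m M).
Hypothesis slotsM : forall x, M x -> in_slots x.
Hypothesis sigmaM : symmetric_measure m M sigma.

(** For [x] in [M], membership of [hopfn x] in the image of [A] means that [edges x] is in [A], so
    [sigma] is the image of [vol] under [edges] divided by the volume. *)
Lemma expectE k (X : set 'M[R]_(n, d)) :
  closed X -> (forall x, M x -> X (edges x)) ->
  exists V I, [/\ 0 < V, invariant_integral M V I &
    expect sigma (Chord k) X = V^-1 * I (chord_form k)].
Proof.
move=> cX MX; have [vol [rv sE]] := sigmaM.
have mM : measurable (M : set (borel 'rV[R]_N)) by exact: measurable_model.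
(* [fine] sends infinity to 0 and 0 has inverse 0, so a zero or infinite volume would make the total
   mass of [sigma] zero. *)
have V0 : fine (vol M) != 0.
  apply/negP => /eqP V0; have := sE setT measurableT.
  rewrite V0 invr0 mul0e probability_setT => /eqP; rewrite eqe.
  exact/negP/oner_neq0.
have Vpos : 0 < fine (vol M).
  by rewrite lt_neqAle eq_sym V0 fine_ge0.
have finM : (vol M < +oo)%E.
  by rewrite ltey; apply: contra V0 => /eqP ->.
exists (fine (vol M)), (model_integral M vol); split => //.
  exact: model_invariant_integral cM chM rv finM.
have mE : measurable_fun setT (edges : borel 'rV[R]_N -> borel 'M[R]_(n, d)).
  exact: continuous_borel continuous_edges.
have mX : measurable (X : set (borel 'M[R]_(n, d))) by exact: closed_borel.
have Vnn : 0 <= (fine (vol M))^-1 by rewrite invr_ge0 ltW.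
have sigmaE (A : set (borel 'M[R]_(n, d))) : measurable A ->
    sigma A = ((fine (vol M))^-1%:E * vol (edges @^-1` A))%E.
  move=> mA; rewrite sE//; congr (_ * _)%E.
  have mEA : measurable (edges @^-1` A : set (borel 'rV[R]_N)).
    by rewrite -[X in measurable X]setTI; exact: mE.
  have -> : M `&` hopfn (n:=n) @^-1` (quat_of_edges (n:=n) @` A) = edges @^-1` A `&` M.
    apply/seteqP; split => [x [Mx /= [e Ae eE]]|x [Ax Mx]].
      by split=> //=; rewrite /edges -eE quat_of_edgesK.
    by split=> //=; exists (edges x) => //; exact: edgesK (slotsM Mx).
  rewrite [RHS](measureDI vol mEA mM).
  rewrite [X in (X + _)%E](_ : _ = 0%E) ?add0e//.
  apply/eqP; rewrite eq_le measure_ge0 andbT -rv.1 le_measure ?inE//.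
  - exact: measurableD.
  - exact: measurableC.
have mC : measurable_fun setT (@Chord R d n k : borel 'M[R]_(n, d) -> R).
  exact: continuous_measurable (@continuous_Chord k).
have C0 e : 0 <= Chord k e by rewrite /Chord sqr_ge0.
pose Xb : set (borel 'M[R]_(n, d)) := X.
pose g : borel 'M[R]_(n, d) -> \bar R := fun e => (Chord k e)%:E.
have mg : measurable_fun Xb g by apply: measurable_funTS; exact/measurable_EFinP.
have cchord : continuous (chord_form k : 'rV[R]_N -> R).
  have RC := ring_class_continuous R 'rV[R]_N.
  apply: (class_sum RC) => l; apply: (class_sum RC) => p.
  exact: continuous_hopf_dot.
have finJ := integrable_fin_num mM (continuous_integrable cM finM cchord).
pose Vn : {nonneg R} := NngNum (ltW Vpos).
(* The volume times [sigma] is the pushforward of [vol] under [edges]; integrals are compared in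
   this form and divided by the volume afterwards. *)
have scaled : ((fine (vol M))%:E * \int[sigma]_(e in Xb) g e =
    \int[vol]_(x in M) (chord_form k x)%:E)%E.
  have g0 e : Xb e -> (0 <= g e)%E by rewrite /g lee_fin.
  rewrite -[X in (X%:E * _)%E]/(Vn%:num) -ge0_integral_mscale//.
  transitivity (\int[vol]_(x in edges @^-1` Xb) (g \o edges) x)%E.
    rewrite -(ge0_integral_pushforward mE vol mX mg); last first.
      by move=> e _; rewrite /g lee_fin.
    apply: eq_measure_integral => A mA _.
    transitivity ((fine (vol M))%:E * sigma A)%E; first by [].
    by rewrite sigmaE// muleA -EFinM mulfV// mul1e.
  have mgE : measurable_fun (edges @^-1` Xb : set (borel 'rV[R]_N)) (g \o edges).
    apply: measurable_funTS; apply/measurable_EFinP.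
    apply: (@continuous_measurable _ _ (fun x => Chord k (edges x))) => x.
    exact: (continuous_comp (@continuous_edges x) (@continuous_Chord k (edges x))).
  have mEX : measurable (edges @^-1` Xb : set (borel 'rV[R]_N)).
    by rewrite -[X in measurable X]setTI; exact: mE.
  (* The complement of [M] is null and is discarded, since the chord is known to equal [chord_form]
     only on [M]. *)
  rewrite (ge0_negligible_integral _ mEX mgE (N := ~` (M : set (borel 'rV[R]_N)))).
  - have -> : edges @^-1` Xb `\` ~` M = M.
      apply/seteqP; split => [x [_ /contrapT//]|x Mx]; split; [exact: MX|by []].
    apply: eq_integral => x /set_mem Mx; rewrite /g /= Chord_edges//.
    exact: slotsM.
  - exact: measurableC.
  - by move=> x _; rewrite /g lee_fin.
  - exact: rv.1.
have J : (\int[sigma]_(e in Xb) g e = (fine (vol M))^-1%:E *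
    \int[vol]_(x in M) (chord_form k x)%:E)%E.
  by rewrite -scaled muleA -EFinM mulVf// mul1e.
rewrite /expect /Rintegral -/Xb -[X in fine X]/(\int[sigma]_(e in Xb) g e)%E J.
by rewrite fineM.
Qed.

End expectation.

End edges.

(** * Closed forms of the four expectations *)

Section expectations.
Context (R : realType) (n k : nat).
Hypothesis hk : (0 < k < n)%N.
Notation N := (n * 4)%N.

Let n1 : (1 < n)%N. Proof. by lia. Qed.
Let n0 : (0 < n)%N. Proof. by lia. Qed.
Let kn : (k <= n)%N. Proof. by lia. Qed.
Let l0 : 'I_n := Ordinal n0.
Let nR0 : 0 < n%:R :> R. Proof. by rewrite ltr0n. Qed.
Let nR1 : 0 < n%:R - 1 :> R. Proof. by rewrite subr_gt0 ltr1n. Qed.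

Lemma real_model_setT (X : set 'rV[R]_N) x : real_model X x -> real_model setT x.
Proof. by case=> -[_ h]; [left|right]. Qed.

Lemma real_model_in_slots (X : set 'rV[R]_N) x : real_model X x -> in_slots 2 x.
Proof.
case=> -[_ h] _ l; have [h1 h2] := h l; rewrite /hopf2 h1 h2; ring.
Qed.

Lemma compact_sub_sphere (X : set 'rV[R]_N) :
  closed X -> X `<=` @sphere_set R n -> compact X.
Proof. by move=> cX SX; exact: subclosed_compact cX (@compact_sphere R n) SX. Qed.

Section chord_values.
Context (M : set 'rV[R]_N) (V : R) (I : ('rV[R]_N -> R) -> R).
Hypotheses (V0 : 0 < V) (HI : invariant_integral M V I).
Hypothesis MS : M `<=` @sphere_set R n.
Hypothesis rotM : forall p q c s, p != q -> c ^+ 2 + s ^+ 2 = 1 ->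
  symmetry M (row_rot p q c s).
Context (a b : R).
Hypotheses (a0 : 0 < a) (ab : a * moment4 I l0 = b * moment2 I l0).

(** The fourth moment depends on the model through [V] and the pair [a], [b] only: (2n + 1, 6) and
    (n + 1, 4) for Arm, (n + 1, 3) and (n + 2, 4) for Pol, with d = 3 listed first. *)
Lemma moment4E : moment4 I l0 = V * (2 * b / (n%:R * a)).
Proof.
have m2 : moment2 I l0 = 2 * V / n%:R.
  apply: (mulfI (lt0r_neq0 nR0)); rewrite (moment2E HI MS rotM l0).
  by field; exact: lt0r_neq0.
apply: (mulfI (lt0r_neq0 a0)); rewrite ab m2.
by field; rewrite !lt0r_neq0.
Qed.

Lemma arm_chord : (forall l, symmetry M (lmul_j l)) ->
  V^-1 * I (chord_form k) = k%:R * (2 * b / (n%:R * a)).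
Proof.
move=> sj; have C0 p q : p != q -> I (fun x => hopf_dot x p q) = 0.
  by move=> pq; exact: (hopf_dot_lmul_j HI pq (sj p)).
rewrite (integral_chord HI rotM l0 kn C0) moment4E.
by field; rewrite !lt0r_neq0.
Qed.

(** Each off-diagonal mean is -1/(n - 1) times the diagonal one, and 1 - (k - 1)/(n - 1) = (n -
    k)/(n - 1). *)
Lemma pol_chord : M `<=` @stiefel_set R n -> V^-1 * I (chord_form k) =
  k%:R * (n%:R - k%:R) / (n%:R - 1) * (2 * b / (n%:R * a)).
Proof.
move=> MP; have nR1' : n%:R - 1 != 0 :> R by exact: lt0r_neq0.
have C0 p q : p != q ->
    I (fun x => hopf_dot x p q) = - (moment4 I l0 / (n%:R - 1)).
  move=> pq; have := stiefel_hopf_dot HI rotM MP pq.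
  rewrite (moment4_const HI rotM p l0) => /eqP; rewrite addrC addr_eq0 => /eqP h.
  by apply: (mulfI nR1'); rewrite h; field.
rewrite (integral_chord HI rotM l0 kn C0) moment4E.
by field; rewrite nR1' !lt0r_neq0.
Qed.

End chord_values.

Lemma expect_Arm3 (sigma : probability (borel 'M[R]_(n, 3)) R) :
  arm_symmetric_measure sigma ->
  expect sigma (Chord k) (@Arm R 3 n) =
  k%:R * (2 * 6 / (n%:R * (2 * n%:R + 1))).
Proof.
rewrite /arm_symmetric_measure /= arm_model3E => sS.
have slots (x : 'rV[R]_N) : in_slots 3 x by [].
have [x Sx|V [I [V0 HI ->]]] := expectE (or_intror erefl)
  (@compact_sphere R n) (@sphere_charts_full R n n0) (fun x _ => slots x) sS k
  (@closed_Arm R 3 n).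
  by apply: edges_Arm => //; right.
have rotM p q (c s : R) (pq : p != q) (cs : c ^+ 2 + s ^+ 2 = 1) :=
  rot_symmetry pq cs (@sphere_S R n).
apply: (arm_chord V0 HI (@subset_refl _ _) rotM); last exact: lmul_j_sphere.
  by rewrite ltr_wpDl// mulr_ge0.
exact: (sphere_moment4 HI (@subset_refl _ _) rotM _ (@lmul_i_sphere R n) (@lmul_j_sphere R n)).
Qed.

Lemma expect_Arm2 (sigma : probability (borel 'M[R]_(n, 2)) R) :
  arm_symmetric_measure sigma ->
  expect sigma (Chord k) (@Arm R 2 n) =
  k%:R * (2 * 4 / (n%:R * (n%:R + 1))).
Proof.
rewrite /arm_symmetric_measure /= arm_model2E => sS.
have MS := @real_model_sub R n (@sphere_set R n).
have cM := compact_sub_sphere (closed_real_model (@closed_sphere R n)) MS.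
have ch : has_charts (2 * n - 1) (real_model (@sphere_set R n)).
  apply: real_model_charts => //; first exact: closed_sphere.
    by apply: sphere_charts_real => //; left.
  by apply: sphere_charts_real => //; right.
have [x Sx|V [I [V0 HI ->]]] := expectE (or_introl erefl) cM ch
  (@real_model_in_slots _) sS k (@closed_Arm R 2 n).
  apply: edges_Arm; [by left|exact: real_model_in_slots Sx|exact: MS].
have rotM p q (c s : R) (pq : p != q) (cs : c ^+ 2 + s ^+ 2 = 1) :=
  rot_symmetry pq cs (real_model_S (@sphere_S R n)).
apply: (arm_chord V0 HI MS rotM); last exact: lmul_j_real_sphere.
  by rewrite addr_gt0.
exact: (real_sphere_moment4 HI MS rotM _ (@real_model_setT _) (@lmul_j_real_sphere R n)).
Qed.

Lemma expect_Pol3 (sigma : probability (borel 'M[R]_(n, 3)) R) :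
  pol_symmetric_measure sigma ->
  expect sigma (Chord k) (@Pol R 3 n) =
  k%:R * (n%:R - k%:R) / (n%:R - 1) * (2 * 3 / (n%:R * (n%:R + 1))).
Proof.
rewrite /pol_symmetric_measure /= pol_model3E => sS.
have MS := @stiefel_sphere R n.
have cM := compact_sub_sphere (@closed_stiefel R n) MS.
have slots (x : 'rV[R]_N) : in_slots 3 x by [].
have [x Sx|V [I [V0 HI ->]]] := expectE (or_intror erefl) cM
  (@stiefel_charts_full R n n1) (fun x _ => slots x) sS k (@closed_Pol R 3 n).
  by apply: edges_Pol => //; right.
have rotM p q (c s : R) (pq : p != q) (cs : c ^+ 2 + s ^+ 2 = 1) :=
  rot_symmetry pq cs (@stiefel_S R n).
have ab := stiefel_moment4 HI MS rotM (@subset_refl _ _) l0 (@lmul_i_stiefel R n).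
apply: (pol_chord V0 HI MS rotM _ ab (@subset_refl _ _)).
by rewrite addr_gt0.
Qed.

Lemma expect_Pol2 (sigma : probability (borel 'M[R]_(n, 2)) R) :
  pol_symmetric_measure sigma ->
  expect sigma (Chord k) (@Pol R 2 n) =
  k%:R * (n%:R - k%:R) / (n%:R - 1) * (2 * 4 / (n%:R * (n%:R + 2))).
Proof.
rewrite /pol_symmetric_measure /= pol_model2E => sS.
have MP := @real_model_sub R n (@stiefel_set R n).
have MS := subset_trans MP (@stiefel_sphere R n).
have cM := compact_sub_sphere (closed_real_model (@closed_stiefel R n)) MS.
have ch : has_charts (2 * n - 3) (real_model (@stiefel_set R n)).
  apply: real_model_charts.
  - exact: closed_stiefel.
  - exact: stiefel_sphere.
  - by apply: stiefel_charts_real => //; left.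
  - by apply: stiefel_charts_real => //; right.
have [x Sx|V [I [V0 HI ->]]] := expectE (or_introl erefl) cM ch
  (@real_model_in_slots _) sS k (@closed_Pol R 2 n).
  by apply: edges_Pol; [left|exact: real_model_in_slots Sx|exact: MP].
have rotM p q (c s : R) (pq : p != q) (cs : c ^+ 2 + s ^+ 2 = 1) :=
  rot_symmetry pq cs (real_model_S (@stiefel_S R n)).
have ab := real_stiefel_moment4 HI MS rotM MP l0 (@real_model_setT _).
by apply: (pol_chord V0 HI MS rotM _ ab MP); rewrite addr_gt0.
Qed.

End expectations.

(** The ends are excluded: for [k = 0] the chord is zero, hence so is the denominator, and for
    [k = n] the chord of a closed polygon and both bounds are zero, against strictness. *)
Theorem mainTheorem6 (R : realType) (d n k : nat)
    (hd : d = 2%N \/ d = 3%N) (hk : (0 < k < n)%N)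
    (sigmaPol sigmaArm : probability (borel 'M[R]_(n, d)) R)
    (hPol : pol_symmetric_measure sigmaPol)
    (hArm : arm_symmetric_measure sigmaArm) :
  let delta : R := k%:R / n%:R in
  (1 - delta) * (n%:R / (n%:R + 1))
    < expect sigmaPol (Chord k) (@Pol R d n)
      / expect sigmaArm (Chord k) (@Arm R d n)
    < (1 - delta) * (n%:R / (n%:R - 1)).
Proof.
lazy zeta; set delta : R := k%:R / n%:R.
have k0 : 0 < k%:R :> R by rewrite ltr0n; lia.
have k1 : k%:R + 1 <= n%:R :> R by rewrite natr1 ler_nat; lia.
have n2 : 2 <= n%:R :> R by rewrite ler_nat; lia.
have n0 : n%:R != 0 :> R by rewrite gt_eqF//; lra.
have np1 : n%:R + 1 != 0 :> R by rewrite gt_eqF//; lra.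
have nm1 : n%:R - 1 != 0 :> R by rewrite gt_eqF//; lra.
(* The ratio is (n - k) / (n - 1) * r with r = E|e_1|^2 on Pol / E|e_1|^2 on Arm. *)
suff [r rE /andP[r1 r2]] : exists2 r : R,
    expect sigmaPol (Chord k) (@Pol R d n) / expect sigmaArm (Chord k) (@Arm R d n)
      = (n%:R - k%:R) / (n%:R - 1) * r & (n%:R - 1) / (n%:R + 1) < r < 1.
  have c0 : 0 < (n%:R - k%:R) / (n%:R - 1) :> R by rewrite divr_gt0//; lra.
  have -> : (1 - delta) * (n%:R / (n%:R + 1)) =
      (n%:R - k%:R) / (n%:R - 1) * ((n%:R - 1) / (n%:R + 1)).
    by rewrite /delta; field; rewrite n0 np1 nm1.
  have -> : (1 - delta) * (n%:R / (n%:R - 1)) = (n%:R - k%:R) / (n%:R - 1) * 1.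
    by rewrite /delta; field; rewrite n0 nm1.
  by rewrite rE !ltr_pM2l// r1 r2.
case: hd => dE; subst d.
- exists ((n%:R + 1) / (n%:R + 2)).
    rewrite (expect_Pol2 hk hPol) (expect_Arm2 hk hArm).
    by field; rewrite n0 np1 nm1 /=; lra.
  have p1 : 0 < n%:R + 1 :> R by lra.
  have p2 : 0 < n%:R + 2 :> R by lra.
  (* Clearing denominators leaves (n - 1)(n + 2) < (n + 1)^2 and n + 1 < n + 2. *)
  by rewrite ltr_pdivrMr// mulrAC ltr_pdivlMr// ltr_pdivrMr// mul1r; apply/andP; split; nra.
- exists ((2 * n%:R + 1) / (2 * (n%:R + 1))).
    rewrite (expect_Pol3 hk hPol) (expect_Arm3 hk hArm).
    by field; rewrite n0 np1 nm1 /=; lra.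
  have p1 : 0 < n%:R + 1 :> R by lra.
  have p2 : 0 < 2 * (n%:R + 1) :> R by lra.
  (* Here the inequalities are 2(n - 1)(n + 1) < (2n + 1)(n + 1) and 2n + 1 < 2n + 2. *)
  by rewrite ltr_pdivrMr// mulrAC ltr_pdivlMr// ltr_pdivrMr// mul1r; apply/andP; split; nra.
Qed.
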